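(* Let $p$ be a prime and $R$ a local ring which is finite as a $\mathbb{Z}_p$-module, with $\mathbb{Z}_p\subset R$ and residue field $\mathbb{F}_R$. For $N\geq 1$ let $\mu_{R,N}$ be the pushforward of the Haar probability measure on $\mathrm{End}_R(R^N)$ under the map $G\mapsto\mathrm{Coker}\,G$ to the set $S_R$ of isomorphism classes of finite $R$-modules; the endomorphisms with infinite cokernel form a set of measure zero. Then the $\mu_{R,N}$ converge in the weak-* topology, as $N\to\infty$, to a probability measure $\mu_R$ supported on $T_R$. For every $M\in T_R$, $$\mu_R(M)=\frac{c_R}{\#\mathrm{Aut}_R(M)},\qquad c_R=\lim_{n\to\infty}\frac{|\mathrm{GL}_n(\mathbb{F}_R)|}{|M_n(\mathbb{F}_R)|}=\prod_{i=1}^\infty\big(1-|\mathbb{F}_R|^{-i}\big).$$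
   Context: $T_R\subseteq S_R$ is the set of finite $R$-modules isomorphic to the cokernel of some $R$-linear endomorphism of $R^N$ for some $N$. *)

(* Defs.v *)
From HB Require Import structures.
From mathcomp Require Import all_boot all_order all_algebra.
From mathcomp Require Import boolp classical_sets functions cardinality.
From mathcomp Require Import reals topology normedtype sequences.
From mathcomp Require Import Rstruct Rstruct_topology.
Set Implicit Arguments. Unset Strict Implicit. Unset Printing Implicit Defensive.
Import Order.TTheory GRing.Theory Num.Theory intZmod.
Local Open Scope classical_set_scope.
Local Open Scope ring_scope.

(* 1. The ring Z_p of p-adic integers, constructed as the inverse limit of    *)
(*    the rings Z/p^k Z: an element is a compatible sequence (x_k)_k of       *)
(*    integers with 0 <= x_k < p^k and x_k = x_{k+1} mod p^k.  (The modulus   *)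
(*    is maxn p 2 so that the construction is a nontrivial ring for every     *)
(*    p : nat; for p prime, maxn p 2 = p.)                                    *)
Section PadicIntegers.
Variable p : nat.

Definition zp_mod (k : nat) : int := ((maxn p 2) ^ k)%N%:Z.
Definition zp_compat (x : nat -> int) : Prop :=
  forall k, x k = modz (x k.+1) (zp_mod k).
Record padic_int := PadicInt { zp_val : nat -> int ; _ : `[< zp_compat zp_val >] }.
HB.instance Definition _ := [isSub for zp_val].
HB.instance Definition _ := [Choice of padic_int by <:].

Lemma zp_modS k : zp_mod k.+1 = zp_mod k * (maxn p 2)%:Z.
Proof. by rewrite /zp_mod expnSr PoszM. Qed.

Lemma modz_modS (n : int) k : modz (modz n (zp_mod k.+1)) (zp_mod k) = modz n (zp_mod k).
Proof.
rewrite zp_modS; have := divz_eq n (zp_mod k * (maxn p 2)%:Z).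
set q := divz _ _; set r := modz n _ => E.
by rewrite [in RHS]E (mulrC (zp_mod k)) mulrA modzMDl.
Qed.

Lemma zp_compatP (x : padic_int) : zp_compat (zp_val x).
Proof. by case: x => x H; apply/asboolP. Qed.

Lemma zp_red (x : padic_int) k : modz (zp_val x k) (zp_mod k) = zp_val x k.
Proof. by rewrite (zp_compatP x k) modz_mod. Qed.

Definition zp_mk (f : nat -> int) (H : zp_compat f) : padic_int :=
  @PadicInt f (asboolT H).

Definition zp_op1 (g : int -> int) (x : padic_int) : nat -> int :=
  fun k => modz (g (zp_val x k)) (zp_mod k).

Lemma zp0_compat : zp_compat (fun k => 0%Z).
Proof. by move=> k; rewrite mod0z. Qed.
Lemma zp1_compat : zp_compat (fun k => modz 1 (zp_mod k)).
Proof. by move=> k; rewrite modz_modS. Qed.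
Lemma zpadd_compat (x y : padic_int) :
  zp_compat (fun k => modz (zp_val x k + zp_val y k) (zp_mod k)).
Proof.
move=> k; rewrite modz_modS (zp_compatP x k) (zp_compatP y k).
by rewrite modzDml modzDmr.
Qed.
Lemma zpopp_compat (x : padic_int) :
  zp_compat (fun k => modz (- zp_val x k) (zp_mod k)).
Proof. by move=> k; rewrite modz_modS (zp_compatP x k) modzNm. Qed.
Lemma zpmul_compat (x y : padic_int) :
  zp_compat (fun k => modz (zp_val x k * zp_val y k) (zp_mod k)).
Proof.
move=> k; rewrite modz_modS (zp_compatP x k) (zp_compatP y k).
by rewrite modzMml modzMmr.
Qed.

Definition zp0 := zp_mk zp0_compat.
Definition zp1 := zp_mk zp1_compat.
Definition zpadd x y := zp_mk (zpadd_compat x y).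
Definition zpopp x := zp_mk (zpopp_compat x).
Definition zpmul x y := zp_mk (zpmul_compat x y).

Lemma zp_eq (x y : padic_int) : (forall k, zp_val x k = zp_val y k) -> x = y.
Proof. by move=> H; apply: val_inj; apply: funext. Qed.

Lemma zpaddA : associative zpadd.
Proof. by move=> x y z; apply: zp_eq => k /=; rewrite modzDml modzDmr addrA. Qed.
Lemma zpaddC : commutative zpadd.
Proof. by move=> x y; apply: zp_eq => k /=; rewrite addrC. Qed.
Lemma zpadd0 : left_id zp0 zpadd.
Proof. by move=> x; apply: zp_eq => k /=; rewrite add0r zp_red. Qed.
Lemma zpaddN : left_inverse zp0 zpopp zpadd.
Proof. by move=> x; apply: zp_eq => k /=; rewrite modzDml addNr mod0z. Qed.

HB.instance Definition _ := GRing.isZmodule.Build padic_int zpaddA zpaddC zpadd0 zpaddN.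

Lemma zpmulA : associative zpmul.
Proof. by move=> x y z; apply: zp_eq => k /=; rewrite modzMml modzMmr mulrA. Qed.
Lemma zpmulC : commutative zpmul.
Proof. by move=> x y; apply: zp_eq => k /=; rewrite mulrC. Qed.
Lemma zpmul1 : left_id zp1 zpmul.
Proof. by move=> x; apply: zp_eq => k /=; rewrite modzMml mul1r zp_red. Qed.
Lemma zpmulDl : left_distributive zpmul zpadd.
Proof.
by move=> x y z; apply: zp_eq => k /=; rewrite modzMml modzDm mulrDl.
Qed.
Lemma zp1_neq0 : zp1 != zp0.
Proof.
apply/eqP => /(congr1 (fun x => zp_val x 1)) /=.
rewrite /zp_mod expn1 modz_small //.
by rewrite ler01 /= ltz_nat leq_max orbT.
Qed.

HB.instance Definition _ := GRing.Zmodule_isComNzRing.Build padic_int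
  zpmulA zpmulC zpmul1 zpmulDl zp1_neq0.
End PadicIntegers.

Notation real := Rdefinitions.R.

Definition is_ideal (R : comNzRingType) (I : set R) : Prop :=
  [/\ I 0, (forall x y, I x -> I y -> I (x + y)) & (forall r x, I x -> I (r * x))].

Definition maximal_ideal (R : comNzRingType) (I : set R) : Prop :=
  [/\ is_ideal I, ~ I 1 &
      forall J : set R, is_ideal J -> I `<=` J -> ~ J 1 -> J = I].

Definition local_ring (R : comNzRingType) : Prop :=
  exists m : set R, maximal_ideal m /\ forall m', maximal_ideal m' -> m' = m.

Definition Zp_module_finite (p : nat) (R : comAlgType (padic_int p)) : Prop :=
  exists s : seq R, forall r : R,
    exists c : nat -> padic_int p, r = \sum_(i < size s) c i *: s`_i.

Definition Zp_subring (p : nat) (R : comAlgType (padic_int p)) : Prop :=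
  injective (fun a : padic_int p => a%:A : R).

Record finModule (R : pzRingType) := FinModule {
  fm_sort :> lmodType R;
  fm_enum : seq fm_sort;
  fm_enumP : forall x : fm_sort, x \in fm_enum }.

Definition is_Rlinear (R : pzRingType) (U V : lmodType R) (f : U -> V) : Prop :=
  (forall x y, f (x + y) = f x + f y) /\ (forall (r : R) x, f (r *: x) = r *: f x).

Definition mod_iso (R : pzRingType) (M1 M2 : finModule R) : Prop :=
  exists f : M1 -> M2, is_Rlinear f /\ bijective f.

(* Aut_R(M) as a set of maps; "#Aut_R(M) = n" is written  aut_set M #= `I_n. *)
Definition aut_set (R : pzRingType) (M : finModule R) : set (M -> M) :=
  [set f | is_Rlinear f /\ bijective f].
Arguments aut_set {R} M _.

Definition is_coker (R : comNzRingType) (N : nat) (G : 'M[R]_N)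
    (M : finModule R) : Prop :=
  exists f : 'rV[R]_N -> M,
    [/\ is_Rlinear f, (forall y : M, exists v, f v = y) &
        (forall v, f v = 0 <-> exists w, v = w *m G)].

Definition coker_set (R : comNzRingType) (N : nat) (M : finModule R) : set 'M[R]_N :=
  [set G | is_coker G M].
Arguments coker_set {R} N M _.

Definition in_TR (R : comNzRingType) (M : finModule R) : Prop :=
  exists N (G : 'M[R]_N), is_coker G M.

(* 5. Haar probability measure on End_R(R^N) = M_N(R) (R with its p-adic     *)
(*    topology).  The subgroups p^k M_N(R) (k : nat) form a basis of open     *)
(*    neighbourhoods of 0 of finite index; the Haar probability measure of a  *)
(*    set U that is a union of cosets of p^k M_N(R) is the proportion of      *)
(*    those cosets contained in U.  haar_value p U v  says that U is such a   *)
(*    (clopen) set for some k and that its Haar measure is v.                 *)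
Definition cong_pk (R : comNzRingType) (p k N : nat) (A B : 'M[R]_N) : Prop :=
  exists C : 'M[R]_N, A - B = ((p ^ k)%N%:R : R) *: C.

Definition coset_reps (R : comNzRingType) (p k N : nat) (s : seq 'M[R]_N) : Prop :=
  (forall A, exists2 B, B \in s & cong_pk p k A B) /\
  (forall i j, (i < size s)%N -> (j < size s)%N ->
     cong_pk p k (nth 0 s i) (nth 0 s j) -> i = j).

Definition haar_value (R : comNzRingType) (p N : nat) (U : set 'M[R]_N) (v : real) : Prop :=
  exists k (s : seq 'M[R]_N),
    [/\ coset_reps p k s,
        (forall A B, cong_pk p k A B -> U A -> U B) &
        v = (count (fun B => `[< U B >]) s)%:R / (size s)%:R].

(* 6. Probability measures on the countable set S_R of isomorphism classes   *)
(*    of finite R-modules, given by their masses mu : finModule R -> real     *)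
(*    (isomorphism invariant): masses are >= 0 and the total mass over        *)
(*    isomorphism classes (sum over any family of pairwise non-isomorphic     *)
(*    modules is <= 1, and can be made arbitrarily close to 1) equals 1.      *)
Fixpoint noniso_to_all (R : pzRingType) (M : finModule R) (s : seq (finModule R)) : Prop :=
  if s is M' :: s' then ~ mod_iso M M' /\ noniso_to_all M s' else True.

Fixpoint pairwise_noniso (R : pzRingType) (s : seq (finModule R)) : Prop :=
  if s is M :: s' then noniso_to_all M s' /\ pairwise_noniso s' else True.

Definition prob_on_classes (R : pzRingType) (mu : finModule R -> real) : Prop :=
  [/\ (forall M, 0 <= mu M),
      (forall M1 M2, mod_iso M1 M2 -> mu M1 = mu M2),
      (forall s, pairwise_noniso s -> \sum_(M <- s) mu M <= 1) &
      (forall eps : real, 0 < eps ->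
         exists2 s, pairwise_noniso s & 1 - eps <= \sum_(M <- s) mu M)].

(* Main.v *)
(* Let M be the cokernel of an N x N matrix. Two surjections R^N -> M differ by an
   element of GL_N(R), since M_N over a local ring has stable range one; hence every
   surjection f has ker f = im G_f for a square matrix G_f. The matrices with rows
   in ker f are the A G_f, and A G_f has the same image as G_f iff A is invertible
   over the residue field F. So im G = ker f has measure |M|^-N |GL_N(F)| / |M_N(F)|,
   and each G with cokernel M arises from exactly #Aut(M) surjections f. Therefore
     mu_N(M) = (|GL_N(F)| / |M_N(F)|) (#Sur(R^N, M) / |M|^N) / #Aut(M),
   and the second factor tends to 1.
   Infinite cokernels have measure zero: for fixed G the cokernel of G + t is large
   for few t only, because the determinant of G + t on a set of Z_p-generators is a
   monic polynomial in t. No mass is lost in the limit, because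
   mu_N(M) <= (|GL_N(F)| / |M_N(F)| / c) mu(M) for every M.
   All measures are counted in M_N(Q) for the finite rings Q = R / p^K. *)
Require Import Defs.
From HB Require Import structures.
From mathcomp Require Import all_boot all_order all_algebra.
From mathcomp Require Import boolp classical_sets functions cardinality.
From mathcomp Require Import reals topology normedtype sequences.
From mathcomp Require Import Rstruct Rstruct_topology.
From mathcomp Require Import ring lra zify.
Import Order.TTheory GRing.Theory Num.Theory.
Local Open Scope ring_scope.
Set Implicit Arguments. Unset Strict Implicit. Unset Printing Implicit Defensive.

(** * Finite quotient rings *)

(** Haar measure is given only to unions of cosets of [p^k M_N(R)], so each event needs a level at
    which it becomes visible. Having cokernel [M] is visible modulo [p^(#|M| + 1)]: [p^#|M|] kills
    [M], hence equals [H G] for some [H], and adding [p^(#|M| + 1) C] to [G] multiplies it on the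
    left by the unit [1 + p C H]. The level depends on [M], so densities are compared across levels
    and a finite family of modules is treated at a common one. Having an infinite cokernel is
    visible at no level; it is replaced by the larger event that [p^k] does not kill the cokernel,
    whose measure tends to 0 with k. [R] may have nilpotents and p-torsion, so a [G] with finite
    cokernel need not be injective, and [A] cannot be recovered from [A G]. Hence only the constancy
    of the fibres of right multiplication by [G] is used, and invertibility of [A] is tested over
    [F]. *)

Section PrincipalQuotient.
Variables (R : comNzRingType) (a : R) (s : seq R).
Hypothesis a_nonunit : ~ exists b, a * b = 1.
Hypothesis s_dense : forall r, exists2 x, x \in s & exists y, r = x + a * y.

Definition principal_ideal : pred R := fun x => `[< exists y, x = a * y >].

Fact principal_ideal_closed : idealr_closed principal_ideal.
Proof.
split; first by apply/asboolP; exists 0; rewrite mulr0.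
  by apply/asboolP => -[b ab]; apply: a_nonunit; exists b.
move=> r x y /asboolP[u ->] /asboolP[v ->]; apply/asboolP.
by exists (r * u + v); rewrite mulrDr mulrCA.
Qed.
HB.instance Definition _ := isIdealr.Build R principal_ideal principal_ideal_closed.

Definition principal_idealr : idealr R := principal_ideal.

Definition pquot : Type := {ideal_quot principal_idealr}.
HB.instance Definition _ := GRing.ComNzRing.on pquot.

Definition pquot_map (x : R) : pquot := (\pi_({ideal_quot principal_idealr}) x)%qT.

Fact pquot_map_zmod : zmod_morphism pquot_map.
Proof. by move=> x y; rewrite /pquot_map rmorphB. Qed.
Fact pquot_map_monoid : monoid_morphism pquot_map.
Proof. by split=> [|x y]; rewrite /pquot_map ?rmorph1 ?rmorphM. Qed.
HB.instance Definition _ := GRing.isZmodMorphism.Build R pquot pquot_map pquot_map_zmod.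
HB.instance Definition _ := GRing.isMonoidMorphism.Build R pquot pquot_map pquot_map_monoid.

Lemma pquot_map_surj (y : pquot) : exists x, pquot_map x = y.
Proof. by exists (repr (y : {ideal_quot principal_idealr})); rewrite /pquot_map reprK. Qed.

Lemma pquot_map_ker x : pquot_map x = 0 <-> exists y, x = a * y.
Proof.
rewrite -(rmorph0 pquot_map) /pquot_map.
transitivity (is_true (x - 0 \in principal_idealr)).
  by rewrite Quotient.idealrBE; split => [->|/eqP].
by rewrite subr0; split => /asboolP.
Qed.

Definition pquot_enum : seq pquot := undup [seq pquot_map x | x <- s].

Lemma mem_pquot_enum y : y \in pquot_enum.
Proof.
rewrite mem_undup; have [x <-] := pquot_map_surj y.
have [x' x's [z ->]] := s_dense x; apply/mapP; exists x' => //.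
by rewrite rmorphD /= (pquot_map_ker (a * z)).2 ?addr0//; exists z.
Qed.

Fact pquot_pickleK : pcancel (fun y : pquot => index y pquot_enum) (onth pquot_enum).
Proof.
by move=> y; have yE := mem_pquot_enum y; rewrite onthE (nth_map y) ?index_mem ?nth_index.
Qed.
HB.instance Definition _ := isCountable.Build pquot pquot_pickleK.
Fact pquot_enumP : Finite.axiom pquot_enum.
Proof. by move=> y; rewrite count_uniq_mem ?undup_uniq ?mem_pquot_enum. Qed.
HB.instance Definition _ := isFinite.Build pquot pquot_enumP.

Lemma finite_quotient_exists :
  exists (Q : finComNzRingType) (rho : {rmorphism R -> Q}),
    (forall y, exists x, rho x = y) /\
    (forall x, rho x = 0 <-> exists y, x = a * y).
Proof.
exists pquot, pquot_map; split; [exact: pquot_map_surj | exact: pquot_map_ker].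
Qed.
End PrincipalQuotient.

(** Nonempty fibres are cosets of the kernel. The map need not be onto, because it will be right
    multiplication by a possibly singular matrix. *)
Lemma card_preim_additive (V W : finZmodType) (f : V -> W) (B : {set W}) :
  {morph f : x y / x + y} ->
  #|[set x | f x \in B]| = (#|[set y in B | [exists x, f x == y]]| * #|[set x | f x == 0%R]|)%N.
Proof.
move=> fD; have f0 : f 0 = 0 by apply: (addrI (f 0)); rewrite -fD !addr0.
rewrite -sum1_card (partition_big f (fun y => y \in [set y in B | [exists x, f x == y]])) /=; last first.
  by move=> x; rewrite !inE => ->; apply/existsP; exists x.
rewrite -sum_nat_const; apply: eq_bigr => y; rewrite inE => /andP[yB /existsP[x0 /eqP fx0]] /=.
rewrite sum1_card -(card_imset [set x | f x == 0] (addrI x0)); apply: eq_card => x.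
rewrite unfold_in /= inE; apply/andP/imsetP => [[_ /eqP fx]|[z]].
  exists (x - x0); last by rewrite addrC subrK.
  by rewrite inE; apply/eqP/(addrI (f x0)); rewrite -fD addrC subrK fx fx0 addr0.
by rewrite inE => /eqP fz ->; rewrite fD fx0 fz addr0 yB.
Qed.

(** * Presentations of finite modules over a local ring *)

(** An alias on which the finite type structure is put; [fm_enum] may repeat elements, so the
    enumeration is deduplicated. *)
Definition fm_carrier (R : pzRingType) (M : finModule R) : Type := M.

Section FmCarrier.
Variables (R : pzRingType) (M : finModule R).
HB.instance Definition _ := GRing.Lmodule.on (fm_carrier M).

Let e : seq (fm_carrier M) := undup (fm_enum M).
Let mem_e (x : fm_carrier M) : x \in e.
Proof. by rewrite mem_undup (@fm_enumP R M). Qed.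

Fact fm_pickleK : pcancel (fun x : fm_carrier M => index x e) (onth e).
Proof. by move=> x; rewrite onthE (nth_map x) ?index_mem ?nth_index. Qed.
HB.instance Definition _ := isCountable.Build (fm_carrier M) fm_pickleK.
Fact fm_carrier_enumP : Finite.axiom e.
Proof. by move=> x; rewrite count_uniq_mem ?undup_uniq ?mem_e. Qed.
HB.instance Definition _ := isFinite.Build (fm_carrier M) fm_carrier_enumP.
End FmCarrier.

(** Write [L = P I_r Q]. Adding [P (1 - I_r) Q] would complete [L] to the unit [P Q]. Only its
    product with [Z2 *m B = 1 - Z1 *m L] is a left multiple of [B], and the resulting error is
    [P N Q] with [N] of square zero, so that [1 - N] is still invertible. *)
Lemma stable_range_field (F : fieldType) n (L B Z1 Z2 : 'M[F]_n) :
  Z1 *m L + Z2 *m B = 1%:M -> exists X, L + X *m B \in unitmx.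
Proof.
move=> LB; pose P := col_ebase L; pose Q := row_ebase L; pose r := \rank L.
have Pu : P \in unitmx := col_ebase_unit L.
have Qu : Q \in unitmx := row_ebase_unit L.
have LE : L = P *m pid_mx r *m Q by rewrite mulmx_ebase.
pose N : 'M[F]_n := copid_mx r *m (Q *m Z1 *m P) *m pid_mx r.
have NN : N *m N = 0.
  by rewrite /N -!mulmxA (mulmxA (pid_mx r)) mul_pid_mx_copid ?rank_leq_row// mul0mx !mulmx0.
exists (P *m copid_mx r *m Q *m Z2).
have -> : L + P *m copid_mx r *m Q *m Z2 *m B = P *m (1%:M - N) *m Q.
  have -> : P *m copid_mx r *m Q *m Z2 *m B = P *m copid_mx r *m Q *m (1%:M - Z1 *m L).
    by rewrite -LB addrC addKr !mulmxA.
  have LD : L + P *m copid_mx r *m Q = P *m Q.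
    by rewrite {1}LE -mulmxDl -mulmxDr /copid_mx (addrC (pid_mx r)) subrK mulmx1.
  have LN : P *m copid_mx r *m Q *m (Z1 *m L) = P *m N *m Q by rewrite {1}LE /N !mulmxA.
  by rewrite mulmxBr mulmx1 LN addrA LD mulmxBr mulmx1 mulmxBl.
rewrite !unitmx_mul Pu Qu andbT /=.
have /mulmx1_unit[]// : (1%:M - N) *m (1%:M + N) = 1%:M.
by rewrite mulmxDr mulmx1 mulmxBl mul1mx NN subr0 subrK.
Qed.

Section LinearMap.
Variables (R : comNzRingType) (M : finModule R) (N : nat).
Implicit Types (x : 'rV[fm_carrier M]_N) (v : 'rV[R]_N).

(** A linear map from R^N to M is stored as the vector of images of the basis, which makes these
    maps a finite type that can be counted. *)
Definition lin x v : fm_carrier M := \sum_i v 0 i *: x 0 i.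

Lemma linD x u v : lin x (u + v) = lin x u + lin x v.
Proof. by rewrite /lin -big_split; apply: eq_bigr => i _; rewrite mxE scalerDl. Qed.
Lemma linZ x a v : lin x (a *: v) = a *: lin x v.
Proof. by rewrite /lin scaler_sumr; apply: eq_bigr => i _; rewrite mxE scalerA. Qed.
Lemma lin0 x : lin x 0 = 0.
Proof. by rewrite -(scale0r 0) linZ scale0r. Qed.
Lemma linB x u v : lin x (u - v) = lin x u - lin x v.
Proof. by rewrite -scaleN1r linD linZ scaleN1r. Qed.
Lemma lin_sum x (I : Type) (s : seq I) (f : I -> 'rV[R]_N) :
  lin x (\sum_(i <- s) f i) = \sum_(i <- s) lin x (f i).
Proof. exact: (big_morph _ (linD x) (lin0 x)). Qed.
Lemma lin_delta x i : lin x (delta_mx 0 i) = x 0 i.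
Proof.
rewrite /lin (bigD1 i)//= mxE !eqxx scale1r big1 ?addr0// => j ji.
by rewrite mxE eqxx (negPf ji) scale0r.
Qed.

Lemma lin_mulmx x v (A : 'M[R]_N) :
  lin x (v *m A) = lin (\row_i lin x (row i A)) v.
Proof.
rewrite mulmx_sum_row lin_sum /lin; apply: eq_bigr => i _.
by rewrite -/(lin x _) linZ mxE.
Qed.

Lemma lin_linear x : is_Rlinear (lin x : 'rV[R]_N -> M).
Proof. by split=> *; [exact: linD | exact: linZ]. Qed.

Lemma linear_lin (f : 'rV[R]_N -> M) : is_Rlinear f ->
  forall v, f v = lin (\row_i (f (delta_mx 0 i) : fm_carrier M)) v.
Proof.
move=> [fD fZ] v.
have f0 : f 0 = 0 by rewrite -(scale0r 0) fZ scale0r.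
rewrite {1}[v]row_sum_delta /lin.
rewrite (big_morph f fD f0); apply: eq_bigr => i _.
by rewrite fZ mxE.
Qed.

Definition lin_surj x := forall y : fm_carrier M, exists v, lin x v = y.
Definition presents x (G : 'M[R]_N) :=
  forall v, lin x v = 0 <-> exists w, v = w *m G.

Lemma is_cokerP (G : 'M[R]_N) :
  is_coker G M <-> exists x, lin_surj x /\ presents x G.
Proof.
split=> [[f [fl fs fk]]|[x [xs xG]]]; last first.
  by exists (lin x); split => //; exact: lin_linear.
exists (\row_i (f (delta_mx 0 i) : fm_carrier M)).
have fE := linear_lin fl.
by split=> [y|v]; [have [v <-] := fs y; exists v; rewrite fE | rewrite -fE].
Qed.

Lemma presents_mull x (G U V : 'M[R]_N) :
  V *m U = 1%:M -> presents x G -> presents x (U *m G).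
Proof.
move=> VU xG v; rewrite xG; split=> -[w ->].
  by exists (w *m V); rewrite mulmxA -(mulmxA w) VU mulmx1.
by exists (w *m U); rewrite mulmxA.
Qed.

Lemma lin_surj_lift x y : lin_surj x -> exists L, forall v, lin x (v *m L) = lin y v.
Proof.
move=> xs; have [l lE] : exists l : 'I_N -> 'rV[R]_N, forall i, lin x (l i) = y 0 i.
  by apply: (@fin_all_exists _ (fun=> 'rV[R]_N) (fun i v => lin x v = y 0 i)) => i; exact: xs.
exists (\matrix_(i < N) l i) => v; rewrite lin_mulmx; congr (lin _ v).
by apply/rowP => i; rewrite mxE rowK lE.
Qed.
End LinearMap.

(** * Finite cokernels over a local ring and their stability under p-adic perturbation *)

Section LocalAlgebra.
Variables (R : comNzRingType) (F : finFieldType) (pi : {rmorphism R -> F}) (p : nat).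
Hypothesis pi_unit : forall r, pi r != 0 -> exists r', r * r' = 1.
Hypothesis pi_p : pi p%:R = 0.
Hypothesis pi_surj : forall y, exists x, pi x = y.
Hypothesis p_neq0 : forall k, (p ^ k)%N%:R != 0 :> R.

Lemma pi_pX k : pi (p ^ k.+1)%N%:R = 0.
Proof. by rewrite expnS natrM rmorphM /= pi_p mul0r. Qed.

Lemma pi_mx_unit n (A : 'M[R]_n) : map_mx pi A \in unitmx ->
  exists B, A *m B = 1%:M /\ B *m A = 1%:M.
Proof.
rewrite unitmxE det_map_mx unitfE => /pi_unit[d dE].
exists (d *: \adj A); rewrite -scalemxAr -scalemxAl mul_mx_adj mul_adj_mx.
by rewrite scale_scalar_mx mulrC dE.
Qed.

(** Equivalently, [p^k] kills the cokernel of [G]: a quantitative finiteness condition, and one that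
    is visible modulo [p^k.+1]. *)
Definition pexp_below k n (G : 'M[R]_n) :=
  exists H : 'M[R]_n, H *m G = (p ^ k)%N%:R%:M.

(** Since [p^k.+1 C = p C H G], the perturbed matrix is [(1 + p C H) G], and [1 + p C H] reduces to
    the identity over the residue field. *)
Lemma pexp_below_perturb k n (G C : 'M[R]_n) : pexp_below k G ->
  exists U V, [/\ V *m U = 1%:M, U *m V = 1%:M & G + (p ^ k.+1)%N%:R *: C = U *m G].
Proof.
move=> [H HG]; pose U := 1%:M + p%:R *: (C *m H).
have [|V [UV VU]] := @pi_mx_unit _ U.
  rewrite map_mxD map_mx1 map_mxZ /= pi_p scale0r addr0; exact: unitmx1.
exists U, V; split=> //.
rewrite mulmxDl mul1mx -scalemxAl -mulmxA HG mul_mx_scalar scalerA.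
by rewrite expnS natrM.
Qed.

Lemma pexp_below_cong k n (A B : 'M[R]_n) :
  cong_pk p k.+1 A B -> pexp_below k A -> pexp_below k B.
Proof.
move=> [C CE] [H HA]; have [U [V [VU UV E]]] := pexp_below_perturb (- C) (ex_intro _ H HA).
have -> : B = U *m A by rewrite -E scalerN -CE opprB addrC subrK.
exists (H *m V); rewrite -mulmxA (mulmxA V) VU mul1mx //.
Qed.

(** Pigeonhole gives [p^i x = p^j x] with [i < j], and [1 - p^(j-i)] is a unit. The exponent is
    generous; what matters is that it depends on [M] alone. *)
Lemma fm_pexp (M : finModule R) (x : fm_carrier M) :
  (p ^ #|{: fm_carrier M}|)%N%:R *: x = 0.
Proof.
pose g (i : 'I_#|{: fm_carrier M}|.+1) : fm_carrier M := (p ^ i)%N%:R *: x.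
have : ~ injective g.
  by move=> /leq_card; rewrite card_ord ltnn.
have [//|] := pselect (exists i j : 'I_#|{: fm_carrier M}|.+1, (i < j)%N /\ g i = g j); last first.
  move=> nij [] i j gij; apply: val_inj; apply/eqP.
  by case: ltngtP => // ij; case: nij; [exists i, j | exists j, i].
move=> [i [j [ij gij]]] _.
have [u uE] : exists u, (1 - (p ^ (j - i))%N%:R) * u = 1 :> R.
  apply: pi_unit; rewrite rmorphB rmorph1 -(subnSK ij) pi_pX subr0; exact: oner_neq0.
have gi0 : (p ^ i)%N%:R *: x = 0.
  have : (1 - (p ^ (j - i))%N%:R) *: ((p ^ i)%N%:R *: x) = 0.
    rewrite scalerBl scale1r [in X in _ - X]scalerA -natrM -expnD subnK 1?ltnW//.
    by rewrite -/(g i) gij subrr.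
  by move/(congr1 (GRing.scale u)); rewrite scalerA mulrC uE scale1r scaler0.
by rewrite -(subnK (leq_ord i)) expnD natrM -scalerA gi0 scaler0.
Qed.

Section Present.
Variables (M : finModule R) (N : nat).
Implicit Types (x : 'rV[fm_carrier M]_N) (G : 'M[R]_N).

Lemma lin_pexp x k v : (#|{: fm_carrier M}| <= k)%N -> lin x ((p ^ k)%N%:R *: v) = 0.
Proof. by move=> /subnK <-; rewrite linZ expnD natrM -scalerA fm_pexp scaler0. Qed.

Lemma presents_rows x G (A : 'M[R]_N) : presents x G ->
  (forall i, lin x (row i A) = 0) -> exists H, A = H *m G.
Proof.
move=> xG xA; have [l lE] : exists l : 'I_N -> 'rV[R]_N, forall i, row i A = l i *m G.
  by apply: (@fin_all_exists _ (fun=> 'rV[R]_N) (fun i v => row i A = v *m G)) => i; exact/xG.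
by exists (\matrix_i l i); apply/row_matrixP => i; rewrite row_mul rowK.
Qed.

Lemma presents_pexp_below x G k : (#|{: fm_carrier M}| <= k)%N ->
  presents x G -> pexp_below k G.
Proof.
move=> Mk xG; have [|H HE] := @presents_rows x G (p ^ k)%N%:R%:M xG; last by exists H.
by move=> i; rewrite -scalemx1 linearZ lin_pexp.
Qed.

Lemma presents_cong x (A B : 'M[R]_N) k : (#|{: fm_carrier M}| < k)%N ->
  cong_pk p k A B -> presents x A -> presents x B.
Proof.
case: k => // k Mk [C CE] xA.
have [U [V [VU UV E]]] := pexp_below_perturb (- C) (presents_pexp_below Mk xA).
have -> : B = U *m A by rewrite -E scalerN -CE opprB addrC subrK.
exact: (presents_mull VU xA).
Qed.

Lemma coker_set_cong (A B : 'M[R]_N) k : (#|{: fm_carrier M}| < k)%N ->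
  cong_pk p k A B -> coker_set N M A -> coker_set N M B.
Proof.
move=> Mk AB /is_cokerP[x [xs xA]]; apply/is_cokerP; exists x; split=> //.
exact: presents_cong AB xA.
Qed.

(* Two lifts L, L0 of the surjections through each other need not be invertible,
   but L + X (1 - L0 L) is again a lift for every X. *)
Lemma presents_exists x0 G0 x : lin_surj x0 -> presents x0 G0 -> lin_surj x ->
  exists G, presents x G.
Proof.
move=> x0s x0G xs.
have [L LE] := lin_surj_lift x x0s; have [L0 L0E] := lin_surj_lift x0 xs.
have [|Xb Xbu] := @stable_range_field F N (map_mx pi L) (1%:M - map_mx pi (L0 *m L))
   (map_mx pi L0) 1%:M.
  by rewrite map_mxM mul1mx addrC subrK.
have [X XE] : exists X : 'M[R]_N, map_mx pi X = Xb.
  have [g gE] := choice pi_surj; exists (map_mx g Xb).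
  by apply/matrixP => i j; rewrite !mxE gE.
have [|V [UV VU]] := @pi_mx_unit _ (L + X *m (1%:M - L0 *m L)).
  by rewrite map_mxD map_mxM map_mxB map_mx1 XE.
set U := L + _ in UV VU.
have UE v : lin x0 (v *m U) = lin x v.
  rewrite mulmxDr linD LE mulmxBr mulmx1 mulmxBr linB !mulmxA LE.
  by rewrite L0E subrr addr0.
exists (G0 *m V) => v; rewrite -UE x0G; split=> -[w wE].
  by exists w; rewrite mulmxA -wE -mulmxA UV mulmx1.
by exists w; rewrite wE -!mulmxA VU mulmx1.
Qed.

(* If B A G = G then det G kills 1 - B A, and det G divides a power of p. *)
Lemma presents_mull_unit x G (A : 'M[R]_N) : presents x G ->
  presents x (A *m G) <-> map_mx pi A \in unitmx.
Proof.
move=> xG; split=> [xAG|/pi_mx_unit[V [AV VA]]]; last exact: (presents_mull VA xG).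
have [|B BE] := @presents_rows x (A *m G) G xAG.
  move=> i; apply/xG; exists (delta_mx 0 i); exact: rowE.
have [H HG] := presents_pexp_below (leqnn _) xG.
set k := #|_| in HG.
have dHG : \det H * \det G = (p ^ (k * N))%N%:R.
  by rewrite -det_mulmx HG det_scalar -natrX expnM.
pose E := 1%:M - B *m A.
have EG : E *m G = 0 by rewrite mulmxBl mul1mx -mulmxA -BE subrr.
have pE : (p ^ (k * N))%N%:R *: E = 0.
  rewrite -dHG -scalerA -(mul_mx_scalar (\det G)) -mul_mx_adj mulmxA EG mul0mx scaler0 //.
(* An entry with nonzero image in [F] would be a unit killed by a power of p, contrary to
   [p_neq0]. *)
have piE : map_mx pi E = 0.
  apply/matrixP => i j; rewrite !mxE; apply/eqP/negPn/negP => /pi_unit[u uE].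
  have /negP[] := p_neq0 (k * N); apply/eqP.
  have := congr1 (fun X : 'M[R]_N => X i j * u) pE.
  by rewrite !mxE -mulrA uE mulr1 mul0r.
have : map_mx pi B *m map_mx pi A = 1%:M.
  apply/eqP; rewrite eq_sym -subr_eq0 -map_mxM -(map_mx1 pi) -map_mxB; exact/eqP.
by case/mulmx1_unit.
Qed.

End Present.
End LocalAlgebra.

(** * Reduction modulo powers of p *)

Lemma card_preim_surj (V W : finZmodType) (f : V -> W) (B : {set W}) :
  {morph f : x y / x + y} -> (forall y, exists x, f x = y) ->
  (#|[set x | f x \in B]| * #|{: W}| = #|B| * #|{: V}|)%N.
Proof.
move=> fD fs; have surjE (C : {set W}) : [set y in C | [exists x, f x == y]] = C.
  apply/setP => y; rewrite inE; case: (y \in C) => //=.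
  by have [x <-] := fs y; apply/existsP; exists x.
have := card_preim_additive [set: W] fD; rewrite surjE cardsT.
have -> : [set x | f x \in [set: W]] = [set: V] by apply/setP => x; rewrite !inE.
rewrite cardsT => ->; rewrite (card_preim_additive B fD) surjE.
by rewrite -!mulnA (mulnC #|[set _ | _]|).
Qed.

Section Reduction.
Variables (R : comNzRingType) (p K : nat) (Q : finComNzRingType) (rho : {rmorphism R -> Q}).
Hypothesis rho_surj : forall y, exists x, rho x = y.
Hypothesis rho_ker : forall x, rho x = 0 <-> exists y, x = (p ^ K)%N%:R * y.

Lemma rho_section : exists sigma : Q -> R, cancel sigma rho.
Proof. by have [g gE] := choice rho_surj; exists g. Qed.

Lemma map_rho_eq m n (A B : 'M[R]_(m, n)) :
  map_mx rho A = map_mx rho B <-> exists C, A - B = (p ^ K)%N%:R *: C.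
Proof.
split=> [AB|[C CE]].
  have [f fE] : exists f : 'I_m * 'I_n -> R,
      forall ij, A ij.1 ij.2 - B ij.1 ij.2 = (p ^ K)%N%:R * f ij.
    apply: (@fin_all_exists _ (fun=> R)
      (fun ij y => A ij.1 ij.2 - B ij.1 ij.2 = (p ^ K)%N%:R * y)) => -[i j].
    apply/rho_ker => /=.
    move/matrixP/(_ i j): AB; rewrite !mxE rmorphB => ->; exact: subrr.
  exists (\matrix_(i, j) f (i, j)); apply/matrixP => i j.
  by rewrite !mxE -(fE (i, j)).
apply/eqP; rewrite -subr_eq0 -map_mxB CE map_mxZ.
by rewrite (rho_ker _).2 ?scale0r//; exists 1; rewrite mulr1.
Qed.

Section Redset.
Variable N : nat.
Implicit Type U : 'M[R]_N -> Prop.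

Definition cong_stable U := forall A B, cong_pk p K A B -> U A -> U B.

Definition redset U : {set 'M[Q]_N} :=
  [set A | `[< exists2 G, map_mx rho G = A & U G >]].

(** Meant for [cong_stable] sets, for which it is the Haar measure. *)
Definition density U : real := #|redset U|%:R / #|{: 'M[Q]_N}|%:R.

Lemma mem_redset U G : cong_stable U -> (map_mx rho G \in redset U) = `[< U G >].
Proof.
move=> US; rewrite inE; apply/asbool_equiv_eq; split=> [[G' G'G UG']|UG]; last by exists G.
by apply: US UG'; apply/map_rho_eq.
Qed.

Lemma map_rho_surj (A : 'M[Q]_N) : exists G, map_mx rho G = A.
Proof.
have [g gK] := rho_section; exists (map_mx g A).
by apply/matrixP => i j; rewrite !mxE gK.
Qed.

Lemma card_mx_gt0 : (0 < #|{: 'M[Q]_N}|)%N.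
Proof. by apply/card_gt0P; exists 0. Qed.

Lemma haar_density U : cong_stable U -> haar_value p U (density U).
Proof.
move=> US; have [g gK] := rho_section.
have rgK : cancel (map_mx g) (map_mx rho : 'M[R]_N -> 'M[Q]_N).
  by move=> A; apply/matrixP => i j; rewrite !mxE gK.
exists K, [seq map_mx g A | A <- enum {: 'M[Q]_N}]; split => //.
  split=> [A|i j].
    exists (map_mx g (map_mx rho A)); first by apply: map_f; rewrite mem_enum.
    by apply/map_rho_eq; rewrite rgK.
  rewrite size_map => iN jN; rewrite (nth_map 0 0 (map_mx g) iN) (nth_map 0 0 (map_mx g) jN) => /map_rho_eq.
  by rewrite !rgK => /eqP; rewrite (nth_uniq 0 iN jN (enum_uniq _)) => /eqP.
rewrite /density size_map -cardE count_map; congr (_%:R / _).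
rewrite cardE -size_filter /enum_mem -filter_predI; congr (size _).
apply: eq_filter => A /=; rewrite -{1}(rgK A) andbT.
exact: mem_redset.
Qed.
End Redset.
End Reduction.

Section LevelChange.
Variables (R : comNzRingType) (p K K' : nat) (Q Q' : finComNzRingType).
Variables (rho : {rmorphism R -> Q}) (rho' : {rmorphism R -> Q'}).
Hypothesis rho_surj : forall y, exists x, rho x = y.
Hypothesis rho_ker : forall x, rho x = 0 <-> exists y, x = (p ^ K)%N%:R * y.
Hypothesis rho_surj' : forall y, exists x, rho' x = y.
Hypothesis rho_ker' : forall x, rho' x = 0 <-> exists y, x = (p ^ K')%N%:R * y.
Hypothesis KK' : (K <= K')%N.

Lemma map_rho_coarse m n (A B : 'M[R]_(m, n)) :
  map_mx rho' A = map_mx rho' B -> map_mx rho A = map_mx rho B.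
Proof.
move=> /(map_rho_eq rho_ker')[C CE]; apply/(map_rho_eq rho_ker).
by exists ((p ^ (K' - K))%N%:R *: C); rewrite CE scalerA -natrM -expnD subnKC.
Qed.

(** Reduction from the finer to the coarser level is additive and onto, hence has fibres of equal
    size. This lets modules with different levels be summed at a common one. *)
Lemma density_level N (U : 'M[R]_N -> Prop) :
  cong_stable p K U -> density rho U = density rho' U.
Proof.
move=> US; have [g gK] := rho_section rho_surj'.
have rgK : cancel (map_mx g) (map_mx rho' : 'M[R]_N -> 'M[Q']_N).
  by move=> A; apply/matrixP => i j; rewrite !mxE gK.
(* The section [g] is not additive, but [f] is, because [rho] factors through [rho']. *)
pose f (A : 'M[Q']_N) : 'M[Q]_N := map_mx rho (map_mx g A).
have fE A : f (map_mx rho' A) = map_mx rho A by apply: map_rho_coarse; rewrite rgK.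
have fD : {morph f : A B / A + B}.
  by move=> A B; rewrite -{1}(rgK A) -{1}(rgK B) -map_mxD fE map_mxD.
have fs B : exists A, f A = B.
  by have [A <-] := map_rho_surj rho_surj B; exists (map_mx rho' A); rewrite fE.
have US' : cong_stable p K' U.
  move=> A B AB; apply: US; apply/(map_rho_eq rho_ker)/map_rho_coarse.
  exact/(map_rho_eq rho_ker').
have := card_preim_surj (redset rho U) fD fs.
have -> : [set A | f A \in redset rho U] = redset rho' U.
  apply/setP => A; rewrite inE -(rgK A) fE (mem_redset rho_ker)//.
  by rewrite (mem_redset rho_ker').
move=> /(congr1 (fun n => n%:R : real)); rewrite !natrM => E.
apply/eqP; rewrite /density eqr_div ?pnatr_eq0 -?lt0n ?card_mx_gt0//.
by rewrite -E.
Qed.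
End LevelChange.

(** * Counting matrices with a given cokernel *)

Section Count.
Variables (R : comNzRingType) (F : finFieldType) (pi : {rmorphism R -> F}) (p : nat).
Hypothesis pi_unit : forall r, pi r != 0 -> exists r', r * r' = 1.
Hypothesis pi_p : pi p%:R = 0.
Hypothesis pi_surj : forall y, exists x, pi x = y.
Hypothesis p_neq0 : forall k, (p ^ k)%N%:R != 0 :> R.
Variables (K : nat) (Q : finComNzRingType) (rho : {rmorphism R -> Q}).
Hypothesis rho_surj : forall y, exists x, rho x = y.
Hypothesis rho_ker : forall x, rho x = 0 <-> exists y, x = (p ^ K)%N%:R * y.
Hypothesis K_gt0 : (0 < K)%N.
Variable N : nat.

Lemma pi_cong (A B : 'M[R]_N) : map_mx rho A = map_mx rho B -> map_mx pi A = map_mx pi B.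
Proof.
move=> /(map_rho_eq rho_ker)[C CE]; apply/eqP; rewrite -subr_eq0 -map_mxB CE map_mxZ.
by rewrite -(prednK K_gt0) /= (pi_pX pi_p) scale0r.
Qed.

Lemma unit_cong_stable : cong_stable p K (fun A : 'M[R]_N => map_mx pi A \in unitmx).
Proof. by move=> A B /(map_rho_eq rho_ker)/pi_cong ->. Qed.

Lemma card_redset_unit :
  (#|redset rho (fun A : 'M[R]_N => map_mx pi A \in unitmx)| * #|{: 'M[F]_N}|
   = #|[set A : 'M[F]_N | A \in unitmx]| * #|{: 'M[Q]_N}|)%N.
Proof.
have [g gK] := rho_section rho_surj.
have rgK : cancel (map_mx g) (map_mx rho : 'M[R]_N -> 'M[Q]_N).
  by move=> A; apply/matrixP => i j; rewrite !mxE gK.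
pose f (A : 'M[Q]_N) : 'M[F]_N := map_mx pi (map_mx g A).
have fE A : f (map_mx rho A) = map_mx pi A by apply: pi_cong; rewrite rgK.
rewrite -(@card_preim_surj _ _ f); first last.
- move=> B; have [h hE] := choice pi_surj; exists (map_mx rho (map_mx h B)).
  by rewrite fE; apply/matrixP => i j; rewrite !mxE hE.
- by move=> A B; rewrite -{1}(rgK A) -{1}(rgK B) -map_mxD fE map_mxD.
congr (#|pred_of_set _| * _)%N; apply/setP => A.
rewrite -(rgK A) (mem_redset rho_ker _ unit_cong_stable) inE fE inE.
by apply/asboolP/idP.
Qed.

Variable M : finModule R.
Hypothesis MK : (#|{: fm_carrier M}| < K)%N.
Implicit Types (x : 'rV[fm_carrier M]_N) (G : 'M[R]_N).

Lemma lin_cong x (u v : 'rV[R]_N) : map_mx rho u = map_mx rho v -> lin x u = lin x v.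
Proof.
move=> /(map_rho_eq rho_ker)[C CE]; apply/eqP; rewrite -subr_eq0 -linB CE.
by rewrite (lin_pexp pi_unit pi_p) // ltnW.
Qed.

Definition rows_killed x G := forall i, lin x (row i G) = 0.

Lemma rows_killed_cong_stable x : cong_stable p K (rows_killed x).
Proof.
move=> A B /(map_rho_eq rho_ker) AB xA i; rewrite -(xA i); apply: lin_cong.
by rewrite !map_row AB.
Qed.

Lemma presents_cong_stable x : cong_stable p K (presents x).
Proof. by move=> A B; apply: (presents_cong pi_unit pi_p MK). Qed.

(** The [N] rows are mapped to [M] independently and onto, so each is killed with probability
    [1 / #|M|]. *)
Lemma card_redset_rows x : lin_surj x ->
  (#|redset rho (rows_killed x)| * #|{: fm_carrier M}| ^ N = #|{: 'M[Q]_N}|)%N.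
Proof.
move=> xs; have [g gK] := rho_section rho_surj.
have rgK : cancel (map_mx g) (map_mx rho : 'M[R]_N -> 'M[Q]_N).
  by move=> A; apply/matrixP => i j; rewrite !mxE gK.
pose f (A : 'M[Q]_N) : 'rV[fm_carrier M]_N := \row_i lin x (row i (map_mx g A)).
have fE A : f (map_mx rho A) = \row_i lin x (row i A).
  by apply/rowP => i; rewrite !mxE; apply: lin_cong; rewrite !map_row rgK.
rewrite -[(_ ^ N)%N](_ : #|{: 'rV[fm_carrier M]_N}| = _); last by rewrite card_mx mul1n.
have := @card_preim_surj _ _ f [set 0] _ _; rewrite cards1 mul1n => <-; first last.
- move=> y; have [l lE] : exists l : 'I_N -> 'rV[R]_N, forall i, lin x (l i) = y 0 i.
    by apply: (@fin_all_exists _ (fun=> 'rV[R]_N) (fun i v => lin x v = y 0 i)) => i; exact: xs.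
  exists (map_mx rho (\matrix_i l i)); rewrite fE; apply/rowP => i.
  by rewrite mxE rowK lE.
- move=> A B; rewrite -{1}(rgK A) -{1}(rgK B) -map_mxD fE.
  by apply/rowP => i; rewrite !mxE linearD linD.
congr (#|pred_of_set _| * _)%N; apply/setP => A.
rewrite -(rgK A) (mem_redset rho_ker _ (@rows_killed_cong_stable x)) inE fE inE.
apply/asboolP/eqP => [xA|xA i]; first by apply/rowP => i; rewrite !mxE.
by move/rowP: xA => /(_ i); rewrite !mxE.
Qed.

(* Right multiplication by G0 maps M_N(Q) onto the matrices with rows in the
   kernel, with fibres of constant size, and GL_N onto those presenting M. *)
Lemma card_redset_presents x G0 : lin_surj x -> presents x G0 ->
  (#|redset rho (presents x)| * (#|{: 'M[F]_N}| * #|{: fm_carrier M}| ^ N)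
   = #|[set A : 'M[F]_N | A \in unitmx]| * #|{: 'M[Q]_N}|)%N.
Proof.
move=> xs xG.
pose f (A : 'M[Q]_N) := A *m map_mx rho G0.
have fE A : f (map_mx rho A) = map_mx rho (A *m G0) by rewrite /f map_mxM.
have fD : {morph f : A B / A + B} by move=> A B; rewrite /f mulmxDl.
(* Rows killed by [x] are combinations of the rows of [G0], so such events lie in the image of
   [f]. *)
have imf (U : 'M[R]_N -> Prop) : (forall G, U G -> rows_killed x G) ->
    [set B in redset rho U | [exists A, f A == B]] = redset rho U.
  move=> Ux; apply/setP => B; rewrite inE; apply/andb_idr.
  rewrite inE => /asboolP[G <-] /Ux/(presents_rows xG)[H ->].
  by apply/existsP; exists (map_mx rho H); rewrite fE.
have Punit := card_preim_additive (redset rho (presents x)) fD.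
rewrite imf in Punit; last by move=> G xG' i; apply/xG'; exists (delta_mx 0 i); exact: rowE.
have Ptot := card_preim_additive (redset rho (rows_killed x)) fD.
rewrite imf // in Ptot.
have E1 : [set A | f A \in redset rho (rows_killed x)] = [set: 'M[Q]_N].
  apply/setP => A; rewrite inE [RHS]inE; have [B <-] := map_rho_surj rho_surj A.
  rewrite fE (mem_redset rho_ker _ (@rows_killed_cong_stable x)); apply/asboolP => i.
  by apply/xG; exists (row i B); rewrite row_mul.
rewrite E1 cardsT in Ptot.
have E2 : [set A | f A \in redset rho (presents x)]
    = redset rho (fun A : 'M[R]_N => map_mx pi A \in unitmx).
  apply/setP => A; rewrite inE; have [B <-] := map_rho_surj rho_surj A.
  rewrite fE (mem_redset rho_ker _ (@presents_cong_stable x)).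
  rewrite (mem_redset rho_ker _ unit_cong_stable).
  by apply/asbool_equiv_eq/(presents_mull_unit pi_unit pi_p p_neq0 _ xG).
rewrite E2 in Punit.
have k0 : (0 < #|[set A : 'M[Q]_N | f A == 0%R]|)%N.
  by apply/card_gt0P; exists 0; rewrite inE /f mul0mx.
apply/eqP; rewrite -(eqn_pmul2r k0); apply/eqP.
have Pr := card_redset_rows xs.
transitivity (#|redset rho (presents x)| * #|[set A : 'M[Q]_N | f A == 0%R]| * #|{: 'M[F]_N}|
              * #|{: fm_carrier M}| ^ N)%N; first by ring.
rewrite -Punit card_redset_unit {1}Ptot -Pr; ring.
Qed.

Definition surj_set : {set 'rV[fm_carrier M]_N} := [set x | `[< lin_surj x >]].
Definition aut_ffun : {set {ffun fm_carrier M -> fm_carrier M}} :=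
  [set h : {ffun fm_carrier M -> fm_carrier M} | `[< is_Rlinear (h : M -> M) /\ bijective h >]].

(** Composition with automorphisms acts simply transitively on the surjections whose kernel is the
    row span of [G]. Between two of them, the automorphism lifts an element along the first and
    applies the second. *)
Lemma card_presenting G : coker_set N M G ->
  #|[set x in surj_set | `[< presents x G >]]| = #|aut_ffun|.
Proof.
move=> /is_cokerP[x0 [x0s x0G]].
pose g (h : {ffun fm_carrier M -> fm_carrier M}) : 'rV[fm_carrier M]_N := \row_i h (x0 0 i).
have gE (h : {ffun fm_carrier M -> fm_carrier M}) v :
    is_Rlinear (h : M -> M) -> lin (g h) v = h (lin x0 v).
  move=> [hD hZ]; have h0 : h 0 = 0.
    by have := hZ 0 0; rewrite !scale0r.
  rewrite {2}/lin (big_morph h hD h0); apply: eq_bigr => i _.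
  by rewrite mxE; symmetry; apply: hZ.
have <- : [set g h | h in aut_ffun] = [set x in surj_set | `[< presents x G >]].
  apply/setP => x; apply/imsetP/idP => [[h]|].
    rewrite inE => /asboolP[hl [k hK kK]] ->; rewrite !inE; apply/andP; split; apply/asboolP.
      move=> y; have [v vE] := x0s (k y); exists v.
      by rewrite gE// vE kK.
    have h0 : h 0 = 0 by have := hl.2 0 0; rewrite !scale0r.
    by move=> v; rewrite gE// -x0G; split=> [E|->//]; apply: (can_inj hK); rewrite E h0.
  rewrite !inE => /andP[/asboolP xs /asboolP xG].
  have [s sE] := choice x0s.
  have [t tE] := choice xs.
  have same v : lin x v = 0 <-> lin x0 v = 0 by rewrite xG x0G.
  have sx v : lin x (s (lin x0 v)) = lin x v.
    by apply/eqP; rewrite -subr_eq0 -linB; apply/eqP/same; rewrite linB sE subrr.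
  have tx v : lin x0 (t (lin x v)) = lin x0 v.
    by apply/eqP; rewrite -subr_eq0 -linB; apply/eqP/same; rewrite linB tE subrr.
  pose h : {ffun fm_carrier M -> fm_carrier M} := [ffun y => lin x (s y)].
  have hE v : h (lin x0 v) = lin x v by rewrite ffunE sx.
  have hl : is_Rlinear (h : M -> M).
    split=> [y z|r y].
      by rewrite -(sE y) -(sE z) -[RHS]/(h _ + h _ : fm_carrier M) -[X in h X]linD !hE linD.
    by rewrite -(sE y) -[RHS]/(r *: h _ : fm_carrier M) -[X in h X]linZ !hE linZ.
  exists h.
    rewrite inE; apply/asboolP; split => //.
    exists (fun y => lin x0 (t y)) => y; first by rewrite ffunE tx sE.
    by rewrite hE tE.
  by apply/rowP => i; rewrite mxE -(lin_delta x0) hE lin_delta.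
apply: card_in_imset => h h'; rewrite !inE => -[hl _] [hl' _] hh'.
apply/ffunP => y; have [v <-] := x0s y.
by rewrite -!gE// hh'.
Qed.

(** Double count of pairs of a matrix and a surjection that it presents. The witness [G0] presents
    one surjection, and [presents_exists] then supplies a matrix for every other. *)
Lemma card_redset_coker G0 : coker_set N M G0 ->
  (#|redset rho (coker_set N M)| * #|aut_ffun| * (#|{: 'M[F]_N}| * #|{: fm_carrier M}| ^ N)
   = #|surj_set| * (#|[set A : 'M[F]_N | A \in unitmx]| * #|{: 'M[Q]_N}|))%N.
Proof.
move=> G0M; have /is_cokerP[x0 [x0s x0G]] := G0M.
have -> : (#|redset rho (coker_set N M)| * #|aut_ffun|
    = \sum_(x in surj_set) #|redset rho (presents x)|)%N.
  transitivity (\sum_(A in redset rho (coker_set N M))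
       #|[set x in surj_set | A \in redset rho (presents x)]|)%N.
    rewrite -sum_nat_const; apply: eq_bigr => A; rewrite inE => /asboolP[G <- GM].
    rewrite -(card_presenting GM); apply: eq_card => x; rewrite !inE; congr (_ && _).
    by have := mem_redset rho_ker G (@presents_cong_stable x); rewrite inE => ->.
  under eq_bigr do rewrite -sum1_card.
  under [RHS]eq_bigr do rewrite -sum1_card.
  rewrite (exchange_big_dep (mem surj_set))/=; last by move=> A x _; rewrite inE => /andP[].
  apply: eq_bigr => x xs; apply: eq_bigl => A; rewrite [in X in _ && X]inE xs /=.
  apply/andb_idl; rewrite !inE => -[G <- xG]; exists G => //.
  by apply/is_cokerP; exists x; split => //; move: xs; rewrite inE => /asboolP.
rewrite big_distrl/= -[RHS]sum_nat_const; apply: eq_bigr => x; rewrite inE => /asboolP xs.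
have [G xG] := presents_exists pi_unit pi_surj x0s x0G xs.
exact: card_redset_presents xs xG.
Qed.
End Count.

Lemma aut_set_card (R : comNzRingType) (M : finModule R) n :
  (aut_set M #= `I_n)%card -> n = #|aut_ffun M|.
Proof.
set a := #|_|; rewrite card_eq_sym => Mn; suff Ma : (aut_set M #= `I_a)%card.
  exact/card_eq_II/(card_eq_trans Mn Ma).
pose e := enum (aut_ffun M); have sz_e : size e = a by rewrite -cardE.
pose g (h : M -> M) : {ffun fm_carrier M -> fm_carrier M} :=
  finfun (h : fm_carrier M -> fm_carrier M).
have gE h : (g h : M -> M) = h by apply: funext => y; exact: ffunE.
have ge h : aut_set M h -> g h \in e by move=> hM; rewrite mem_enum inE; apply/asboolP; rewrite gE.
apply/card_set_bijP; exists (fun h => index (g h) e); split.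
- by move=> h /ge; rewrite -index_mem sz_e.
- move=> h h' /[!inE] /ge he /ge h'e /(congr1 (nth (g id) e)).
  by rewrite !nth_index// => gh; rewrite -(gE h) gh gE.
- move=> i /= ia; exists (nth (g id) e i : M -> M).
    have : nth (g id) e i \in e by rewrite mem_nth ?sz_e.
    by rewrite mem_enum inE => /asboolP.
  have -> : g (nth (g id) e i : M -> M) = nth (g id) e i.
    by apply/ffunP => y; rewrite ffunE.
  by rewrite index_uniq ?sz_e ?enum_uniq.
Qed.

(** * Infinite cokernels have measure zero *)

(** As [f] is monic of degree [D], replacing the last row of the Vandermonde matrix by the values of
    [f] is a unitriangular operation [C] and keeps the determinant; that row is divisible by [q]. *)
Lemma dvdz_vandermonde (f : {poly int}) D (a : 'rV[int]_D.+1) (q : int) :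
  f \is monic -> size f = D.+1 -> (forall i, (q %| f.[a 0 i]%R)%Z) ->
  (q %| (\prod_(i < D.+1) \prod_(j < D.+1 | (i < j)%N) (a 0 j - a 0 i))%R)%Z.
Proof.
move=> fm fs fq; rewrite -det_Vandermonde.
pose C : 'M[int]_D.+1 := \matrix_(i, j) if i == ord_max then f`_j else (i == j)%:R.
have Ctrig : is_trig_mx C.
  apply/is_trig_mxP => i j ij; rewrite mxE; case: eqP => [iE|_].
    by have := leq_trans ij (leq_ord j); rewrite iE ltnn.
  by rewrite -val_eqE (ltn_eqF ij).
have <- : \det (C *m Vandermonde D.+1 a) = \det (Vandermonde D.+1 a).
  rewrite det_mulmx det_trig// big1 ?mul1r// => i _; rewrite mxE eqxx.
  by case: eqP => // ->; rewrite -[RHS](monicP fm) lead_coefE fs.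
rewrite (expand_det_row _ ord_max); apply: rpred_sum => j _; apply: dvdz_mulr.
have -> : (C *m Vandermonde D.+1 a) ord_max j = f.[a 0 j]; last exact: fq.
by rewrite horner_coef fs mxE; apply: eq_bigr => i _; rewrite !mxE eqxx.
Qed.

Lemma horner_char_poly_det (R : comNzRingType) n (A : 'M[R]_n) t :
  (char_poly A).[t] = \det (t%:M - A).
Proof.
rewrite /char_poly -[LHS]/(horner_eval t _) -det_map_mx; congr (\det _).
apply/matrixP => i j; by rewrite !mxE /= /horner_eval hornerD hornerN hornerC hornerMn hornerX.
Qed.

(* The determinants are the values of a monic polynomial of degree D. *)
Lemma few_small_det p L D k (m : 'M[int]_D) (t : 'I_D.+1 -> nat) :
  (1 < p)%N -> injective t -> (forall i, t i < p ^ L)%N ->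
  (L * (D.+1 * D.+1) < k)%N ->
  (forall i, ((p ^ k)%N%:Z %| \det (m + ((t i)%:Z)%:M)%R)%Z) -> False.
Proof.
move=> p1 tI tL kL tdvd.
have := @dvdz_vandermonde (char_poly (- m)) D (\row_i (t i)%:Z) (p ^ k)%N%:Z
  (char_poly_monic _) (size_char_poly _).
have tdvd' i : ((p ^ k)%N%:Z %| (char_poly (- m)).[(\row_i (t i)%:Z) 0 i]%R)%Z.
  by rewrite horner_char_poly_det mxE opprK addrC.
move=> /(_ tdvd'); set x := \prod_(i < _) _ => px.
have x0 : x != 0.
  apply/prodf_neq0 => i _; apply/prodf_neq0 => j ij; rewrite !mxE subr_eq0 eqz_nat.
  by apply/eqP => /tI ji; rewrite ji ltnn in ij.
(* At most [D.+1] squared factors, each at most [p ^ L]: the origin of the bound imposed on [k]. *)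
have xle : (`|x| <= p ^ (L * (D.+1 * D.+1)))%N.
  have rowle (P : 'I_D.+1 -> pred 'I_D.+1) i :
      (\prod_(j < D.+1 | P i j) `|((t j)%:Z - (t i)%:Z)%R| <= p ^ (L * D.+1))%N.
    apply: (@leq_trans (\prod_(j < D.+1 | P i j) p ^ L)).
      apply: leq_prod => j _; have := tL i; have := tL j; lia.
    rewrite prod_nat_const -expnM leq_exp2l// leq_mul2l.
    by rewrite (leq_trans (max_card _)) ?card_ord ?orbT.
  rewrite /x (big_morph absz abszM (erefl _)).
  apply: (@leq_trans (\prod_(i < D.+1) p ^ (L * D.+1))).
    apply: leq_prod => i _; rewrite (big_morph absz abszM (erefl _)).
    under eq_bigr do rewrite !mxE.
    exact: (rowle (fun i j => (i < j)%N)).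
  by rewrite prod_nat_const card_ord -expnM -mulnA.
have := dvdn_leq _ px; rewrite absz_gt0 => /(_ x0).
rewrite /= leqNgt => /negP; apply; apply: leq_ltn_trans xle _.
by rewrite ltn_exp2l.
Qed.

Section FiniteGeneration.
Variables (R : comNzRingType) (p : nat).

(* Generation of R as a Z_p-module, with the coefficients truncated to integers. *)
Definition int_generates_mod (s : seq R) :=
  forall K r, exists (c : 'I_(size s) -> int) r',
    r = \sum_i (c i)%:~R * s`_i + (p ^ K)%N%:R * r'.

(** The rows of [S] are the vectors [s_l e_j], which generate R^N. It matters that [D] and [S] are
    fixed before the precision [K]. *)
Lemma generating_rows s N : int_generates_mod s ->
  exists D (S : 'M[R]_(D, N)), forall K n (A : 'M[R]_(n, N)),
    exists (C : 'M[int]_(n, D)) (B : 'M[R]_(n, N)),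
      A = map_mx intr C *m S + (p ^ K)%N%:R *: B.
Proof.
move=> sg; pose T : finType := ('I_N * 'I_(size s))%type.
exists #|T|, (\matrix_(a < #|T|, j < N) (s`_(enum_val a : T).2 *+ ((enum_val a : T).1 == j))).
move=> K n A.
have [c cE] : exists c : 'I_n * 'I_N -> ('I_(size s) -> int) * R, forall ij,
    A ij.1 ij.2 = \sum_l ((c ij).1 l)%:~R * s`_l + (p ^ K)%N%:R * (c ij).2.
  apply: (@fin_all_exists _ (fun=> (('I_(size s) -> int) * R)%type)
    (fun ij c => A ij.1 ij.2 = \sum_l (c.1 l)%:~R * s`_l + (p ^ K)%N%:R * c.2)) => ij.
  by have [c [r' E]] := sg K (A ij.1 ij.2); exists (c, r').
exists (\matrix_(i < n, a < #|T|) (c (i, (enum_val a : T).1)).1 (enum_val a : T).2).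
exists (\matrix_(i, j) (c (i, j)).2).
apply/matrixP => i j; rewrite !mxE (cE (i, j)) /=; congr (_ + _).
rewrite (reindex (@enum_rank T)) /=; last first.
  by exists enum_val => a _; rewrite ?enum_rankK ?enum_valK.
rewrite (eq_bigr (fun a : T => (((c (i, a.1)).1 a.2)%:~R * s`_a.2) *+ (a.1 == j))); last first.
  by move=> a _; rewrite !mxE enum_rankK mulrnAr.
rewrite -(pair_big xpredT xpredT (fun a1 a2 => (((c (i, a1)).1 a2)%:~R * s`_a2) *+ (a1 == j)))/=.
rewrite (bigD1 j)//= [X in _ + X]big1 ?addr0; last first.
  by move=> a /negPf aj; rewrite big1// => l _; rewrite aj.
by apply: eq_bigr => l _; rewrite eqxx.
Qed.
End FiniteGeneration.

Section MeasureZero.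
Variables (R : comNzRingType) (F : finFieldType) (pi : {rmorphism R -> F}) (p : nat).
Hypothesis p_prime : prime p.
Hypothesis pi_unit : forall r, pi r != 0 -> exists r', r * r' = 1.
Hypothesis pi_p : pi p%:R = 0.

Lemma coprime_unit (u : int) : ~~ (p%:Z %| u)%Z -> exists v, u%:~R * v = 1 :> R.
Proof.
move=> pu; apply: pi_unit; rewrite rmorph_int; apply/eqP => u0.
have [[a b] /= ab] : exists ab : int * int, ab.1 * p%:Z + ab.2 * u = 1.
  have : coprimez p%:Z u by rewrite coprimezE/= prime_coprime.
  by case/coprimezP=> -[a b] /= E; exists (a, b).
have := congr1 (fun z : int => z%:~R : F) ab.
rewrite rmorphD !rmorphM /= u0 mulr0 addr0 -[p%:~R](rmorph_nat pi) pi_p mulr0 => /eqP.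
by rewrite eq_sym oner_eq0.
Qed.

(** Here [d] is [p^j] times a unit of [R] with [j <= k], so scaling gives [p^k = Y G + p^k.+1 Z],
    and the error is absorbed by inverting [1 - p Z]. This makes integer coefficients, known only
    modulo [p^k.+1], good enough. *)
Lemma pexp_below_of_mod k n (G X W : 'M[R]_n) (d : int) : ~~ ((p ^ k.+1)%N%:Z %| d)%Z ->
  d%:~R%:M = X *m G + (p ^ k.+1)%N%:R *: W -> pexp_below p k G.
Proof.
move=> pd E.
have d0 : d != 0 by apply: contraNneq pd => ->; rewrite dvdz0.
pose j := logn p `|d|; have jk : (j <= k)%N.
  rewrite leqNgt; apply: contra pd => kj.
  by rewrite dvdzE /= pfactor_dvdn ?absz_gt0.
have [u dE] : exists u, d = (p ^ j)%N%:Z * u.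
  have : ((p ^ j)%N%:Z %| d)%Z by rewrite dvdzE/= pfactor_dvdn ?absz_gt0.
  by case/dvdzP => u ->; exists u; rewrite mulrC.
have [|v uv] := @coprime_unit u.
  apply/negP => /dvdzP[w uE]; have : (p ^ j.+1 %| `|d|)%N.
    by rewrite dE uE !abszM /= expnSr mulnCA dvdn_mull.
  by rewrite pfactor_dvdn ?absz_gt0// ltnn.
pose w := (p ^ (k - j))%N%:R * v.
have wd : w * d%:~R = (p ^ k)%N%:R.
  rewrite dE rmorphM /= -[(p ^ j)%N%:~R]/((p ^ j)%N%:R) -[in RHS](subnK jk) expnD natrM /w.
  by rewrite mulrACA (mulrC v) uv mulr1.
have E' : (p ^ k)%N%:R%:M = w *: (X *m G) + (p ^ k.+1)%N%:R *: (w *: W).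
  by rewrite -wd -scale_scalar_mx E scalerDr !scalerA [w * (p ^ _)%N%:R]mulrC.
have [|V [UV VU]] := pi_mx_unit pi_unit (A := 1%:M - p%:R *: (w *: W)).
  by rewrite map_mxB map_mx1 map_mxZ /= pi_p scale0r subr0 unitmx1.
exists (V *m (w *: X)).
have : w *: X *m G = (1%:M - p%:R *: (w *: W)) *m (p ^ k)%N%:R%:M.
  rewrite mul_mx_scalar scalerBr scalemx1 {1}E' -scalemxAl (scalerA (p ^ k)%N%:R p%:R) mulrC.
  by rewrite -natrM -expnS addrK.
by rewrite -mulmxA => ->; rewrite mulmxA VU mul1mx.
Qed.

Variables (s : seq R).
Hypothesis s_gen : int_generates_mod p s.

(** On the generators, [G + t] acts modulo [p^k.+1] as an integer matrix [m + t]. By the adjugate, a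
    bad [t] forces [p^k.+1] to divide [det (m + t)], and [few_small_det] excludes [D.+1] such
    values. *)
Lemma few_bad_translates N : exists D, forall L k, (L * (D.+1 * D.+1) <= k)%N ->
  forall G : 'M[R]_N,
  (#|[set t : 'I_(p ^ L) | ~~ `[< pexp_below p k (G + (t%:R)%:M) >]]| <= D)%N.
Proof.
have [D [S SE]] := generating_rows N s_gen.
exists D => L k kL G; rewrite leqNgt; apply/negP => Dlt.
have [m [W SG]] := SE k.+1 _ (S *m G).
have [C [W' C1]] := SE k.+1 _ (1%:M : 'M[R]_N).
set B := [set t | _] in Dlt.
pose t (i : 'I_D.+1) : 'I_(p ^ L) := enum_val (widen_ord Dlt i).
have tB i : t i \in B := enum_valP _.
apply: (@few_small_det p L D k.+1 m (fun i => t i) (prime_gt1 p_prime)) => //.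
- by move=> i j /val_inj/enum_val_inj /(congr1 val) /= /val_inj.
move=> i; have := tB i; rewrite inE; apply: contraNT => pd; apply/asboolP.
pose m' := m + ((t i : nat)%:Z)%:M.
have mS : map_mx intr m' *m S = S *m (G + ((t i)%:R)%:M) - (p ^ k.+1)%N%:R *: W.
  rewrite map_mxD mulmxDl mulmxDr SG addrAC addrK; congr (_ + _).
  by rewrite map_scalar_mx mul_mx_scalar mul_scalar_mx.
(* [C] writes the standard basis in the generators, which turns the adjugate identity on generators
   into one for [det m'] times the identity of size [N]. *)
pose A := map_mx intr C *m map_mx intr (\adj m') : 'M[R]_(N, D).
apply: (@pexp_below_of_mod k N _ (A *m S)
   ((\det m')%:~R *: W' - A *m W) (\det m') pd).
have AE : A *m (map_mx intr m' *m S) = (\det m')%:~R *: (map_mx intr C *m S).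
  rewrite /A -!mulmxA (mulmxA (map_mx _ (\adj _))) -map_mxM mul_adj_mx map_scalar_mx.
  by rewrite mul_scalar_mx -scalemxAr.
have -> : (\det m')%:~R%:M = (\det m')%:~R *: (map_mx intr C *m S)
    + (p ^ k.+1)%N%:R *: ((\det m')%:~R *: W').
  by rewrite scalerA [(p ^ _)%N%:R * _]mulrC -scalerA -scalerDr -C1 scalemx1.
rewrite -AE mS mulmxBr mulmxA -scalemxAr scalerBr -addrA; congr (_ + _); exact: addrC.
Qed.

(** Averaging over scalar translations, which preserve the counting measure: each matrix has at most
    [D] bad translates among [p ^ L], so the density is at most [D / p ^ L]. *)
Lemma density_bad N (eps : real) : 0 < eps -> exists k,
  forall (Q : finComNzRingType) (rho : {rmorphism R -> Q}),
  (forall y, exists x, rho x = y) ->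
  (forall x, rho x = 0 <-> exists y, x = (p ^ k.+1)%N%:R * y) ->
  density rho (fun G : 'M[R]_N => ~ pexp_below p k G) <= eps.
Proof.
move=> eps0; have [D DE] := few_bad_translates N.
have [L LE] : exists L, D%:R / eps <= (p ^ L)%N%:R.
  exists (Num.bound (D%:R / eps)); apply/ltW/(lt_le_trans (archi_boundP _)).
    by rewrite divr_ge0// ltW.
  by rewrite ler_nat ltnW// ltn_expl// prime_gt1.
exists (L * (D.+1 * D.+1))%N; set k := (L * _)%N => Q rho rho_surj rho_ker.
set U := fun G => _.
have US : cong_stable p k.+1 U.
  move=> A B /(map_rho_eq rho_ker) AB UA UB; apply: UA.
  by apply: (pexp_below_cong pi_unit pi_p _ UB); apply/(map_rho_eq rho_ker).
have cnt : (p ^ L * #|redset rho U| <= D * #|{: 'M[Q]_N}|)%N.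
  rewrite -{1}(card_ord (p ^ L)) -sum_nat_const.
  rewrite (eq_bigr (fun t : 'I_(p ^ L) =>
      #|[set A : 'M[Q]_N | A + t%:R%:M \in redset rho U]|)); last first.
    move=> t _; rewrite -[RHS](card_imset _ (addIr t%:R%:M)).
    apply: eq_card => A; apply/idP/imsetP => [AU|[B + ->]]; last by rewrite inE.
    exists (A - t%:R%:M); [rewrite inE | ]; by rewrite subrK.
  under eq_bigr do rewrite -sum1_card.
  rewrite (exchange_big_dep predT)//=.
  rewrite mulnC -sum_nat_const; apply: leq_sum => A _.
  rewrite sum1_card; have [G <-] := map_rho_surj rho_surj A.
  apply: leq_trans (DE L k (leqnn _) G); apply: subset_leq_card; apply/fintype.subsetP => t.
  move=> tU; have {tU} : map_mx rho G \in [set A | A + t%:R%:M \in redset rho U] := tU.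
  rewrite !finset.in_set => /asboolP[G' G'E G'bad]; apply/asboolPn.
  apply: US G'bad; apply/(map_rho_eq rho_ker).
  by rewrite G'E map_mxD map_scalar_mx /= rmorph_nat.
rewrite /density ler_pdivrMr ?ltr0n ?card_mx_gt0//.
have pL0 : 0 < (p ^ L)%N%:R :> real by rewrite ltr0n expn_gt0 prime_gt0.
rewrite -(ler_pM2l pL0); apply: (@le_trans _ _ (D%:R * #|{: 'M[Q]_N}|%:R)).
  by rewrite -!natrM ler_nat.
rewrite mulrA ler_wpM2r//.
by rewrite -ler_pdivrMr.
Qed.
End MeasureZero.

(** * Local rings finite over the p-adic integers *)

Section ResidueField.
Local Open Scope classical_set_scope.

Lemma proper_ideal_in_maximal (R : comNzRingType) (I : set R) :
  is_ideal I -> ~ I 1 -> exists2 A, maximal_ideal A & I `<=` A.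
Proof.
move=> Iid I1.
(* Zorn_bigcup also asks for the union of the empty chain. *)
pose P : set (set R) := fun A => A = set0 \/ [/\ is_ideal A, ~ A 1 & I `<=` A].
have [FF FP Ftot|A [PA Amax]] := @Zorn_bigcup R P.
  have [[A FA [a Aa]]|none] := pselect (exists2 A, FF A & A !=set0); last first.
    left; rewrite -subset0 => x [A FA Ax]; case: none.
    by exists A => //; exists x.
  have big B : FF B -> B !=set0 -> [/\ is_ideal B, ~ B 1 & I `<=` B].
    by move=> /FP[->|//] [].
  have [[A0 AD AM] A1 IA] := big _ FA (ex_intro _ a Aa).
  right; split.
  - split=> [|x y [B FB Bx] [C FC Cy]|r x [B FB Bx]]; first by exists A.
      have [[_ BD _] _ _] := big _ FB (ex_intro _ x Bx).
      have [[_ CD _] _ _] := big _ FC (ex_intro _ y Cy).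
      by case: (Ftot _ _ FB FC) => [BC|CB]; [exists C => //; apply: CD => //; exact: BC
        | exists B => //; apply: BD => //; exact: CB].
    have [[_ _ BM] _ _] := big _ FB (ex_intro _ x Bx).
    by exists B => //; exact: BM.
  - move=> [B FB B1]; have [_ nB _] := big _ FB (ex_intro _ _ B1); exact: nB.
  - by move=> x Ix; exists A => //; exact: IA.
have [[I0 _ _] PI] : is_ideal I /\ P I by split => //; right; split.
case: PA => [A0|[Aid A1 IA]].
  case: (Amax I) => //; rewrite A0; split=> [|/(_ _ I0)] //.
exists A => //; split=> // J Jid AJ J1; apply/seteqP; split=> // x Jx.
apply: contrapT => Ax; apply: (Amax J).
  by split=> // /(_ _ Jx).
by right; split=> //; exact: subset_trans AJ.
Qed.

(** The kernel of [pi] is maximal, hence the only maximal ideal, and a non-unit lies in some maximal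
    ideal. *)
Lemma local_residue_unit (R : comNzRingType) (F : fieldType) (pi : {rmorphism R -> F}) :
  local_ring R -> (forall y, exists x, pi x = y) ->
  forall r, pi r != 0 -> exists r', r * r' = 1.
Proof.
move=> [m [mmax muniq]] pi_surj r pir; apply: contrapT => rNunit.
pose kerpi : set R := [set x | pi x = 0].
have kermax : maximal_ideal kerpi.
  split=> [||J [J0 JD JM] kJ J1].
  - split=> [|x y x0 y0|a x x0]; rewrite /kerpi /=; first exact: rmorph0.
      by rewrite rmorphD x0 y0 addr0.
    by rewrite rmorphM x0 mulr0.
  - by rewrite /kerpi /= rmorph1; apply/eqP; exact: oner_neq0.
  - apply/seteqP; split=> // x Jx; apply/eqP/negPn/negP => pix; apply: J1.
    have [y yE] := pi_surj (pi x)^-1.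
    rewrite -(subrK (y * x) 1); apply: JD; last exact: JM.
    by apply: kJ; rewrite /kerpi /= rmorphB rmorph1 rmorphM /= yE mulVf// subrr.
have [||A Amax rA] := @proper_ideal_in_maximal R [set x | exists y, x = r * y].
- split=> [|x y [a ->] [b ->]|a x [b ->]]; first by exists 0; rewrite mulr0.
    by exists (a + b); rewrite mulrDr.
  by exists (a * b); rewrite mulrCA.
- by move=> [y ry]; apply: rNunit; exists y.
have : A r by apply: rA; exists 1; rewrite mulr1.
by rewrite (muniq _ Amax) -(muniq _ kermax) /kerpi /= => /eqP; rewrite (negPf pir).
Qed.

End ResidueField.

(** * Division and truncation in Z_p, and consequences for finite Z_p-algebras *)

Section Padic.
Variable p : nat.
Hypothesis p_prime : prime p.

Lemma zp_modE k : zp_mod p k = (p ^ k)%N%:Z.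
Proof. by rewrite /zp_mod (maxn_idPl (prime_gt1 p_prime)). Qed.

Lemma zp_val_nat n k : zp_val (n%:R : padic_int p) k = ((n : int) %% zp_mod p k)%Z.
Proof.
elim: n => [|n IHn]; first by rewrite mod0z.
rewrite -[n.+1%:R]/(n.+1%:R) mulrS /= IHn modzDml modzDmr.
by rewrite -[n.+1]add1n PoszD.
Qed.

Lemma zp_val_modz (x : padic_int p) k j : zp_val x k = (zp_val x (k + j) %% zp_mod p k)%Z.
Proof.
elim: j => [|j IHj]; first by rewrite addn0 zp_red.
rewrite IHj addnS (zp_compatP x (k + j)) !zp_modE expnD PoszM.
set n := zp_val x _; have := divz_eq n ((p ^ k)%N%:Z * (p ^ j)%N%:Z).
set q := divz _ _; set r := modz n _ => E.
by rewrite [in RHS]E (mulrC (p ^ k)%N%:Z) mulrA modzMDl.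
Qed.

Lemma padic_divp (x : padic_int p) K : zp_val x K = 0 ->
  exists y, x = (p ^ K)%N%:R * y.
Proof.
move=> xK0; have pK0 : (p ^ K)%N%:Z != 0 by rewrite eqz_nat -lt0n expn_gt0 prime_gt0.
have pKx j : zp_val x (j + K) = (p ^ K)%N%:Z * divz (zp_val x (j + K)) (p ^ K)%N%:Z.
  apply/esym; rewrite mulrC; apply: divzK; apply/dvdz_mod0P.
  by rewrite -zp_modE addnC -zp_val_modz xK0.
(* The index shift by [K] restores the precision lost in dividing by [p ^ K]. *)
have yc : zp_compat p (fun j => divz (zp_val x (j + K)) (p ^ K)%N%:Z).
  move=> j; apply: (mulfI pK0); rewrite mulz_modr ?lt0r ?pK0//.
  by rewrite -!pKx addSn (zp_compatP x (j + K)) !zp_modE expnD PoszM mulrC.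
exists (zp_mk yc); apply: zp_eq => k /=; rewrite zp_val_nat.
by rewrite modzMml -pKx -zp_val_modz.
Qed.

Lemma padic_trunc (x : padic_int p) K : exists (c : nat) y, x = c%:R + (p ^ K)%N%:R * y.
Proof.
have x0 : (0 <= zp_val x K) by rewrite -zp_red modz_ge0 // zp_modE eqz_nat -lt0n expn_gt0 prime_gt0.
have [|y yE] := @padic_divp (x - `|zp_val x K|%N%:R) K.
  by rewrite /= zp_val_nat gez0_abs// modzNm modzDmr subrr mod0z.
by exists `|zp_val x K|%N, y; rewrite -yE addrC subrK.
Qed.

Variable R : comAlgType (padic_int p).
Hypothesis R_sub : Zp_subring R.
Hypothesis R_fin : Zp_module_finite R.

Lemma natr_padic n : n%:R = (n%:R : padic_int p)%:A :> R.
Proof. by rewrite scaler_nat. Qed.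

Lemma pX_neq0 k : (p ^ k)%N%:R != 0 :> R.
Proof.
apply/eqP => pk0; have : ((p ^ k)%N%:R : padic_int p)%:A = (0 : padic_int p)%:A :> R.
  by rewrite -natr_padic pk0 scale0r.
move=> /R_sub /(congr1 (fun x => zp_val x k.+1)); rewrite zp_val_nat /= zp_modE.
rewrite modz_small; last by rewrite lez_nat /= ltz_nat ltn_exp2l ?prime_gt1.
by move/eqP; rewrite eqz_nat -leqn0 leqNgt expn_gt0 prime_gt0.
Qed.

Lemma Zp_finite_generates : exists s : seq R, int_generates_mod p s.
Proof.
have [s sE] := R_fin; exists s => K r; have [c cE] := sE r.
have [d dE] := choice (fun i => padic_trunc (c i) K).
have [e eE] := choice dE.
exists (fun i => (d i)%:Z), (\sum_(i < size s) e i *: s`_i).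
rewrite cE mulr_sumr -big_split; apply: eq_bigr => i _ /=.
rewrite -[_%:~R]/((d i)%:R : R) [in LHS](eE i) scalerDl -scalerA !scaler_nat.
by rewrite !mulr_natl.
Qed.

(** The polynomial [det (1 - X m) - 1] vanishes at 0, so X divides it. *)
Lemma det_one_sub (A : comNzRingType) n (a : A) (m : 'M[A]_n) :
  exists b, \det (1%:M - a *: m) = 1 - a * b.
Proof.
pose q : {poly A} := \det (1%:M - 'X *: map_mx polyC m).
have qE t : q.[t] = \det (1%:M - t *: m).
  rewrite -[LHS]/(horner_eval t _) /q -det_map_mx; congr (\det _); apply/matrixP => i j.
  by rewrite !mxE /= /horner_eval hornerD hornerN hornerM hornerX hornerC hornerMn hornerC.
have : root (q - 1) 0.
  by rewrite /root hornerD hornerN hornerC qE scale0r subr0 det1 subrr.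
case/factor_theorem => r rE; exists (- r.[a]); rewrite -qE.
have /(congr1 (horner^~ a)) := rE.
rewrite hornerD hornerN hornerC hornerM hornerXsubC subr0 => /eqP.
by rewrite subr_eq => /eqP ->; rewrite mulrN opprK addrC mulrC.
Qed.

(* If p were invertible, R = pR would vanish by Nakayama over Z_p. *)
Lemma p_nonunit u : p%:R * u <> 1 :> R.
Proof.
move=> pu; have [s sE] := R_fin.
have [m mE] : exists m : 'I_(size s) -> (nat -> padic_int p), forall i : 'I_(size s),
    u * s`_i = \sum_(j < size s) m i j *: s`_j.
  by apply: (@fin_all_exists _ (fun=> nat -> padic_int p)
    (fun (i : 'I_(size s)) c => u * s`_i = \sum_(j < size s) c j *: s`_j)) => i; exact: sE.
pose m1 : 'M[padic_int p]_(size s) := \matrix_(i < size s, j < size s) m i j.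
pose T := 1%:M - p%:R *: m1.
pose v : 'cV[R]_(size s) := \col_(i < size s) s`_i.
have Tv : map_mx (in_alg R) T *m v = 0.
  rewrite map_mxB map_mx1 mulmxBl mul1mx; apply/colP => i; rewrite !mxE.
  apply/eqP; rewrite subr_eq0; apply/eqP; rewrite -[LHS]mul1r -pu -mulrA mE mulr_sumr.
  by apply: eq_bigr => j _; rewrite !mxE /= mulr_algl -scalerA scaler_nat mulr_natl.
have dv : (\det T)%:A = 0 :> R.
  have [c cE] := sE 1.
  have : map_mx (in_alg R) (\adj T) *m (map_mx (in_alg R) T *m v) = 0 by rewrite Tv mulmx0.
  rewrite mulmxA -map_mxM mul_adj_mx map_scalar_mx mul_scalar_mx => dv.
  rewrite -[_%:A]mulr1 [X in _ * X]cE mulr_sumr big1// => i _.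
  have dvi : (\det T)%:A * s`_i = 0 by have /colP/(_ i) := dv; rewrite !mxE.
  by rewrite -scalerAr dvi scaler0.
have [b bE] := det_one_sub p%:R m1.
(* Since Z_p embeds in [R], this gives [1 = p b] in Z_p, which fails modulo p. *)
move: dv; rewrite -(scale0r 1) => /R_sub; rewrite -/T in bE; rewrite bE => /eqP.
rewrite subr_eq0 => /eqP /(congr1 (fun x => zp_val x 1)).
rewrite /= zp_val_nat zp_modE expn1 modzz mul0r mod0z modz_small //.
by rewrite ler01 /= ltz_nat prime_gt1.
Qed.
End Padic.

(** * Cokernels as finite modules *)

Section CokernelModule.
Variables (R : comNzRingType) (N : nat) (G : 'M[R]_N).

Definition row_span : pred 'rV[R]_N := fun v => `[< exists w, v = w *m G >].

Fact row_span_zmod_closed : zmod_closed row_span.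
Proof.
split; first by apply/asboolP; exists 0; rewrite mul0mx.
by move=> u v /asboolP[x ->] /asboolP[y ->]; apply/asboolP; exists (x - y); rewrite mulmxBl.
Qed.
HB.instance Definition _ := GRing.isZmodClosed.Build _ row_span row_span_zmod_closed.
Definition row_span_zmod : zmodClosed 'rV[R]_N := GRing.ZmodClosed.clone _ row_span _.

Definition coker_mod : Type := Quotient.quot row_span_zmod.
HB.instance Definition _ := GRing.Zmodule.on coker_mod.

Definition coker_pi (v : 'rV[R]_N) : coker_mod := (\pi_(Quotient.quot row_span_zmod) v)%qT.
Definition coker_repr (x : coker_mod) : 'rV[R]_N := repr (x : Quotient.quot row_span_zmod).

Lemma coker_reprK x : coker_pi (coker_repr x) = x.
Proof. by rewrite /coker_pi /coker_repr reprK. Qed.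
Lemma coker_piD u v : coker_pi (u + v) = coker_pi u + coker_pi v.
Proof. exact: raddfD. Qed.
Lemma coker_pi_eq u v : coker_pi u = coker_pi v <-> exists w, u - v = w *m G.
Proof.
transitivity (is_true (u - v \in row_span_zmod)).
  by rewrite Quotient.idealrBE; split => [/eqP|/eqP].
by split => /asboolP.
Qed.

(** The quotient is one of additive groups; the action is put on representatives, and [coker_piZ]
    shows that their choice is immaterial. *)
Definition coker_scale (a : R) (x : coker_mod) : coker_mod := coker_pi (a *: coker_repr x).

Lemma coker_piZ a v : coker_pi (a *: v) = coker_scale a (coker_pi v).
Proof.
apply/coker_pi_eq; rewrite -scalerBr.
have [w ->] : exists w, v - coker_repr (coker_pi v) = w *m G.
  by apply/coker_pi_eq; rewrite coker_reprK.
by exists (a *: w); rewrite scalemxAl.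
Qed.

Fact coker_scaleA a b v : coker_scale a (coker_scale b v) = coker_scale (a * b) v.
Proof. by rewrite -[v]coker_reprK -!coker_piZ scalerA. Qed.
Fact coker_scale1 : left_id 1 coker_scale.
Proof. by move=> v; rewrite -[v]coker_reprK -!coker_piZ scale1r. Qed.
Fact coker_scaleDr : right_distributive coker_scale +%R.
Proof.
move=> a u v; rewrite -[u]coker_reprK -[v]coker_reprK -coker_piD -!coker_piZ.
by rewrite scalerDr coker_piD.
Qed.
Fact coker_scaleDl v : {morph coker_scale^~ v : a b / a + b}.
Proof. by move=> a b; rewrite -[v]coker_reprK -!coker_piZ scalerDl coker_piD. Qed.
HB.instance Definition _ := GRing.Zmodule_isLmodule.Build R coker_mod
  coker_scaleA coker_scale1 coker_scaleDr coker_scaleDl.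

Lemma coker_module_exists (s : seq 'rV[R]_N) :
  (forall v, exists2 u, u \in s & exists w, v - u = w *m G) ->
  exists M : finModule R, coker_set N M G.
Proof.
move=> sE; have enumP (x : coker_mod) : x \in [seq coker_pi u | u <- s].
  have [u us [w uw]] := sE (coker_repr x); apply/mapP; exists u => //.
  by rewrite -[x]coker_reprK; apply/coker_pi_eq; exists w.
exists (@FinModule R coker_mod _ enumP), coker_pi; split.
- by split=> [u v|a v]; [exact: coker_piD | exact: coker_piZ].
- by move=> y; exists (coker_repr y); rewrite coker_reprK.
- have pi0 : coker_pi 0 = 0 by apply: (addrI (coker_pi 0)); rewrite -coker_piD !addr0.
  move=> v; split=> [|[w wE]].
    by rewrite -[X in _ = X]pi0 => /coker_pi_eq; rewrite subr0.
  by rewrite -[RHS]pi0; apply/coker_pi_eq; exists w; rewrite subr0.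
Qed.
End CokernelModule.

(** * Isomorphism classes of cokernels *)

Section ModuleIso.
Variable R : comNzRingType.
Implicit Types M : finModule R.

Lemma Rlinear_inv M1 M2 (f : M1 -> M2) (g : M2 -> M1) :
  cancel f g -> cancel g f -> is_Rlinear f -> is_Rlinear g.
Proof.
move=> fK gK [fD fZ]; split=> [x y|r x]; apply: (can_inj fK).
  by rewrite fD !gK.
by rewrite fZ !gK.
Qed.

Lemma mod_iso_sym M1 M2 : mod_iso M1 M2 -> mod_iso M2 M1.
Proof.
move=> [f [fl [g fK gK]]]; exists g; split; last by exists f.
exact: Rlinear_inv fl.
Qed.

Lemma coker_set_iso N M1 M2 (G : 'M[R]_N) :
  mod_iso M1 M2 -> coker_set N M1 G -> coker_set N M2 G.
Proof.
move=> [h [[hD hZ] [k hK kK]]] [f [[fD fZ] fs fk]].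
have h0 : h 0 = 0 by rewrite -(scale0r 0) hZ scale0r.
exists (h \o f); split.
- by split=> *; rewrite /= ?fD ?fZ.
- by move=> y; have [v vE] := fs (k y); exists v; rewrite /= vE kK.
- by move=> v; rewrite -fk /=; split=> [|->//]; rewrite -[X in _ = X]h0 => /(can_inj hK).
Qed.

Lemma coker_set_unique N M1 M2 (G : 'M[R]_N) :
  coker_set N M1 G -> coker_set N M2 G -> mod_iso M1 M2.
Proof.
have ker_eq (M M' : finModule R) (f : 'rV[R]_N -> M) (g : 'rV[R]_N -> M') :
    is_Rlinear f -> is_Rlinear g -> (forall v, f v = 0 <-> g v = 0) ->
    forall u v, f u = f v -> g u = g v.
  move=> [fD fZ] [gD gZ] fg u v uv; apply/eqP; rewrite -subr_eq0.
  rewrite -[g v]scale1r -scaleNr -gZ -gD; apply/eqP/fg.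
  by rewrite fD fZ uv scaleN1r subrr.
move=> [f1 [f1l f1s f1k]] [f2 [f2l f2s f2k]].
have f12 v : f1 v = 0 <-> f2 v = 0 by rewrite f1k f2k.
have [s1 s1E] := choice f1s; have [s2 s2E] := choice f2s.
have hE v : f2 (s1 (f1 v)) = f2 v by apply: (ker_eq _ _ f1 f2) => //; rewrite s1E.
have kE v : f1 (s2 (f2 v)) = f1 v.
  exact: (ker_eq _ _ f2 f1 f2l f1l (fun w => iff_sym (f12 w)) _ _ (s2E _)).
exists (fun y => f2 (s1 y)); split.
  split=> [x y|r x]; first by rewrite -(s1E x) -(s1E y) -f1l.1 !hE f2l.1.
  by rewrite -(s1E x) -f1l.2 !hE f2l.2.
exists (fun y => f1 (s2 y)) => y; first by rewrite kE s1E.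
by rewrite hE s2E.
Qed.

(** On a pairwise non-isomorphic list this is the indicator that the cokernel of [G] occurs there;
    it turns a sum of masses into an average over matrices. *)
Definition coker_count N (s : seq (finModule R)) (G : 'M[R]_N) : nat :=
  (\sum_(M <- s) `[< coker_set N M G >])%N.

Lemma coker_count_noniso N s M (G : 'M[R]_N) : coker_set N M G ->
  (coker_count s G = 0)%N -> noniso_to_all M s.
Proof.
rewrite /coker_count => GM; elim: s => //= M' s IHs; rewrite big_cons => /eqP.
rewrite addn_eq0 => /andP[/eqP M'0 /eqP/IHs s0]; split=> // MM'.
by move: M'0; rewrite asboolT//; exact: coker_set_iso GM.
Qed.

Lemma noniso_coker_count N s M (G : 'M[R]_N) : coker_set N M G ->
  noniso_to_all M s -> (coker_count s G = 0)%N.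
Proof.
rewrite /coker_count => GM; elim: s => [|M' s IHs] /=; first by rewrite big_nil.
move=> [MM' /IHs s0]; rewrite big_cons s0 addn0; case: asboolP => // GM'.
by case: MM'; exact: coker_set_unique GM GM'.
Qed.

Lemma coker_count_le1 N s (G : 'M[R]_N) : pairwise_noniso s -> (coker_count s G <= 1)%N.
Proof.
elim: s => [|M s IHs] /=; first by rewrite /coker_count big_nil.
move=> [Ms /IHs s1]; rewrite /coker_count big_cons; case: asboolP => // GM.
by have := noniso_coker_count GM Ms; rewrite /coker_count => ->.
Qed.

Lemma coker_list_exists N (l : seq 'M[R]_N) :
  exists2 s, pairwise_noniso s &
    forall G, G \in l -> (exists M, coker_set N M G) -> (0 < coker_count s G)%N.
Proof.
elim: l => [|G l [s sn sl]]; first by exists [::].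
have [[M GM]|GN] := pselect (exists M, coker_set N M G); last first.
  by exists s => // G'; rewrite inE => /predU1P[->//|]; exact: sl.
have [s0|s0] := posnP (coker_count s G); last first.
  by exists s => // G'; rewrite inE => /predU1P[->//|]; exact: sl.
exists (M :: s); first by split => //; exact: coker_count_noniso GM s0.
move=> G'; rewrite inE /coker_count big_cons => /predU1P[->|/sl G's /G's s'0].
  by rewrite asboolT.
by rewrite addn_gt0 [X in _ || X]s'0 orbT.
Qed.

(** Adding an identity block leaves the cokernel unchanged. *)
Lemma in_TR_coker_set M : in_TR M -> exists N0, forall N, (N0 <= N)%N ->
  exists G, coker_set N M G.
Proof.
move=> [N0 [G0 [f [[fD fZ] fs fk]]]]; exists N0 => N /subnKC <-.
exists (block_mx G0 0 0 1%:M), (fun v => f (lsubmx v)); split.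
- by split=> *; rewrite ?linearD ?linearZ ?fD ?fZ.
- by move=> y; have [v vE] := fs y; exists (row_mx v 0); rewrite row_mxKl.
- move=> v; rewrite fk; split=> -[w wE].
    exists (row_mx w (rsubmx v)).
    by rewrite mul_row_block !mulmx0 addr0 add0r mulmx1 -wE hsubmxK.
  exists (lsubmx w); rewrite wE -{1}[w]hsubmxK mul_row_block.
  by rewrite row_mxKl mulmx0 addr0.
Qed.
End ModuleIso.

(** * The cokernel measures *)

Section CokernelMeasure.
Variables (R : comNzRingType) (F : finFieldType) (pi : {rmorphism R -> F}) (p : nat).
Hypothesis p_prime : prime p.
Hypothesis pi_unit : forall r, pi r != 0 -> exists r', r * r' = 1.
Hypothesis pi_p : pi p%:R = 0.
Hypothesis pi_surj : forall y, exists x, pi x = y.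
Hypothesis p_neq0 : forall k, (p ^ k)%N%:R != 0 :> R.
Variables (s : seq R) (s_gen : int_generates_mod p s).
Variables (Q : nat -> finComNzRingType) (rho : forall k, {rmorphism R -> Q k}).
Hypothesis rho_surj : forall k y, exists x, rho k x = y.
Hypothesis rho_ker : forall k x, rho k x = 0 <-> exists y, x = (p ^ k.+1)%N%:R * y.

Local Notation msize M := #|{: fm_carrier M}|.

(** The map [rho k] is reduction modulo [p^k.+1], so the index [msize M] already gives an exponent
    above [#|M|]. *)
Definition mu (N : nat) (M : finModule R) : real :=
  density (rho (msize M)) (coker_set N M).

Lemma coker_set_stable N M k : (msize M <= k)%N -> cong_stable p k.+1 (@coker_set R N M).
Proof. by move=> Mk A B; apply: (coker_set_cong pi_unit pi_p). Qed.

Lemma mu_level N M k : (msize M <= k)%N -> mu N M = density (rho k) (coker_set N M).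
Proof.
move=> Mk; apply: (density_level (@rho_surj _) (@rho_ker _) (@rho_surj k) (@rho_ker k)) => //.
exact: coker_set_stable.
Qed.

Lemma haar_mu N M : haar_value p (coker_set N M) (mu N M).
Proof. by apply: (haar_density (@rho_surj _) (@rho_ker _)); exact: coker_set_stable. Qed.

Lemma mu_ge0 N M : 0 <= mu N M.
Proof. by rewrite /mu /density divr_ge0. Qed.

Lemma mu_eq0 N M : (forall G, ~ coker_set N M G) -> mu N M = 0.
Proof.
move=> none; rewrite /mu /density (_ : redset _ _ = finset.set0) ?cards0 ?mul0r//.
by apply/setP => A; rewrite finset.in_set finset.in_set0; apply/asboolP => -[G _ /none].
Qed.

Lemma mu_mod_iso N M1 M2 : mod_iso M1 M2 -> mu N M1 = mu N M2.
Proof.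
move=> M12; pose k := maxn (msize M1) (msize M2).
rewrite (@mu_level _ _ k) ?leq_maxl// (@mu_level _ _ k) ?leq_maxr//; congr density.
apply/funext => G; apply/propext; split; apply: coker_set_iso => //.
exact: mod_iso_sym.
Qed.

Lemma sum_mu_count N (l : seq (finModule R)) k (g : 'M[Q k]_N -> 'M[R]_N) :
  (forall A, map_mx (rho k) (g A) = A) -> (\max_(M <- l) msize M <= k)%N ->
  \sum_(M <- l) mu N M = (\sum_A coker_count l (g A))%N%:R / #|{: 'M[Q k]_N}|%:R.
Proof.
move=> gK; elim: l => [_|M l IHl].
  rewrite big_nil big1 ?mul0r// => A _; by rewrite /coker_count big_nil.
rewrite !big_cons geq_max => /andP[Mk /IHl ->].
rewrite (@mu_level _ _ k)// /density -mulrDl -natrD; congr (_%:R / _).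
rewrite -sum1_card big_mkcond -big_split; apply: eq_bigr => A _ /=.
rewrite /coker_count big_cons -{1}(gK A) (mem_redset (@rho_ker k)); last exact: coker_set_stable.
by case: `[< _ >].
Qed.

Lemma rho_mx_section N k : exists g : 'M[Q k]_N -> 'M[R]_N, forall A, map_mx (rho k) (g A) = A.
Proof. by have [g gE] := choice (map_rho_surj (@rho_surj k) (N := N)); exists g. Qed.

Lemma sum_mu_le1 N l : pairwise_noniso l -> \sum_(M <- l) mu N M <= 1.
Proof.
move=> ln; have [g gK] := rho_mx_section N (\max_(M <- l) msize M).
rewrite (sum_mu_count gK)// ler_pdivrMr ?ltr0n ?card_mx_gt0// mul1r ler_nat.
rewrite -[leqRHS]muln1 -sum_nat_const; apply: leq_sum => A _; exact: coker_count_le1.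
Qed.

Lemma pexp_below_coker N k (G : 'M[R]_N) : pexp_below p k G -> exists M, coker_set N M G.
Proof.
move=> [H HG]; have [g gK] := rho_section (@rho_surj k).
apply: (coker_module_exists (s := [seq map_mx g a | a <- enum {: 'rV[Q k]_N}])) => v.
exists (map_mx g (map_mx (rho k) v)); first by apply: map_f; rewrite mem_enum.
have [C ->] : exists C, v - map_mx g (map_mx (rho k) v) = (p ^ k.+1)%N%:R *: C.
  by apply/(map_rho_eq (@rho_ker k))/matrixP => i j; rewrite !mxE gK.
exists (p%:R *: (C *m H)); rewrite -scalemxAl -mulmxA HG mul_mx_scalar scalerA.
by rewrite expnS natrM.
Qed.

(** Unlike in [coker_set_cong], the level comes from [A] and not from the size of [M], so it is
    uniform over all cokernels killed by [p^k]. *)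
Lemma coker_set_perturb N M k (A B : 'M[R]_N) : pexp_below p k A ->
  cong_pk p k.+1 A B -> coker_set N M A -> coker_set N M B.
Proof.
move=> Ak [C CE] /is_cokerP[x [xs xA]]; apply/is_cokerP; exists x; split=> //.
have [U [V [VU _ E]]] := pexp_below_perturb pi_unit pi_p (- C) Ak.
have -> : B = U *m A by rewrite -E scalerN -CE opprB addrC subrK.
exact: (presents_mull VU xA).
Qed.

(** Outside a set of density [eps], [p^k] kills the cokernel, which then depends only on the class
    modulo [p^k.+1]. The finite cokernels of finitely many representatives therefore carry the
    remaining mass. *)
Lemma sum_mu_ge N (eps : real) : 0 < eps ->
  exists2 l, pairwise_noniso l & 1 - eps <= \sum_(M <- l) mu N M.
Proof.
move=> eps0; have [k kE] := density_bad p_prime pi_unit pi_p s_gen N eps0.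
have {kE} := kE _ _ (@rho_surj k) (@rho_ker k).
set bad := fun G => _ => bad_le.
have [g gK] := rho_mx_section N k.
have [l ln lE] := coker_list_exists [seq g A | A <- enum {: 'M[Q k]_N}].
exists l => //.
(* The listed modules may be too large for level [k], so everything is counted at the finer level
   [k']. *)
pose k' := maxn k (\max_(M <- l) msize M).
have [g' g'K] := rho_mx_section N k'.
rewrite (sum_mu_count g'K) ?leq_maxr//.
have bad_stable : cong_stable p k.+1 bad.
  move=> A B /(map_rho_eq (@rho_ker k)) AB Abad Bbad; apply: Abad.
  by apply: (pexp_below_cong pi_unit pi_p _ Bbad); apply/(map_rho_eq (@rho_ker k)).
have kk' : (k.+1 <= k'.+1)%N by rewrite ltnS leq_maxl.
rewrite (density_level (@rho_surj k) (@rho_ker k) (@rho_surj k') (@rho_ker k') kk') // in bad_le.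
rewrite lerBlDr; apply: le_trans (lerD (lexx _) bad_le).
rewrite /density -mulrDl ler_pdivlMr ?ltr0n ?card_mx_gt0// mul1r -natrD ler_nat.
rewrite -[#|redset _ _|]sum1_card [X in (_ + X)%N]big_mkcond -big_split -sum1_card.
apply: leq_sum => A _ /=.
have bad_stable' : cong_stable p k'.+1 bad.
  move=> B B' /(map_rho_eq (@rho_ker k')) BB'; apply: bad_stable.
  apply/(map_rho_eq (@rho_ker k)).
  exact: (map_rho_coarse (@rho_ker k) (@rho_ker k') kk').
rewrite -{2}(g'K A) (mem_redset (@rho_ker k') _ bad_stable').
case: asboolP => [_|/contrapT Agood]; first by rewrite addn1.
rewrite addn0; pose B := g (map_mx (rho k) (g' A)).
have AB : map_mx (rho k) (g' A) = map_mx (rho k) B by rewrite gK.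
have Bgood : pexp_below p k B.
  by apply: (pexp_below_cong pi_unit pi_p _ Agood); apply/(map_rho_eq (@rho_ker k)).
apply: (@leq_trans (coker_count l B)).
  apply: lE; last exact: pexp_below_coker Bgood.
  by apply: map_f; rewrite mem_enum.
apply: leq_sum => M _; case: (asboolP (coker_set N M B)) => // BM.
rewrite asboolT//; apply: (coker_set_perturb Bgood _ BM).
by apply/(map_rho_eq (@rho_ker k)).
Qed.

Definition gl_ratio N : real :=
  #|[set A : 'M[F]_N | A \in unitmx]|%:R / #|{: 'M[F]_N}|%:R.

Definition surj_ratio N (M : finModule R) : real := #|surj_set N M|%:R / (msize M ^ N)%N%:R.

Lemma msize_gt0 (M : finModule R) : (0 < msize M)%N.
Proof. by apply/card_gt0P; exists 0. Qed.

Lemma aut_ffun_gt0 (M : finModule R) : (0 < #|aut_ffun M|)%N.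
Proof.
apply/card_gt0P; exists (finfun id); rewrite finset.in_set; apply/asboolP.
have -> : ((finfun id : {ffun fm_carrier M -> fm_carrier M}) : M -> M) = id.
  by apply: funext => x; rewrite ffunE.
by split; [split | exists id].
Qed.

Lemma mu_formula N M G : coker_set N M G ->
  mu N M = gl_ratio N * surj_ratio N M / #|aut_ffun M|%:R.
Proof.
move=> GM; have := card_redset_coker pi_unit pi_p pi_surj p_neq0
  (@rho_surj (msize M)) (@rho_ker (msize M)) isT (leqnn _) GM.
move=> /(congr1 (fun n => n%:R : real)); rewrite !natrM => E.
rewrite /mu /density /gl_ratio /surj_ratio.
have W0 : #|{: 'M[Q (msize M)]_N}|%:R != 0 :> real by rewrite pnatr_eq0 -lt0n card_mx_gt0.
have F0 : #|{: 'M[F]_N}|%:R != 0 :> real by rewrite pnatr_eq0 -lt0n card_mx_gt0.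
have A0 : #|aut_ffun M|%:R != 0 :> real by rewrite pnatr_eq0 -lt0n aut_ffun_gt0.
have M0 : (msize M ^ N)%N%:R != 0 :> real by rewrite pnatr_eq0 -lt0n expn_gt0 msize_gt0.
have solve (S a f m x g W : real) : W != 0 -> f != 0 -> a != 0 -> m != 0 ->
    S * a * (f * m) = x * (g * W) -> S / W = g / f * (x / m) / a.
  move=> {}W0 {}F0 {}A0 {}M0 {}E; have -> : S = x * (g * W) / (a * (f * m)).
    by rewrite -E -[S * a * _]mulrA mulfK// !mulf_neq0.
  by field; rewrite W0 F0 A0 M0.
exact: solve.
Qed.
End CokernelMeasure.

(** * Limits *)

Section EulerProduct.
Local Open Scope classical_set_scope.
Variable q : real.
Hypothesis q_ge2 : 2 <= q.

Definition euler_prod (n : nat) : real := \prod_(i < n) (1 - q ^- i.+1).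

Lemma euler_factor i : 0 <= q ^- i.+1 <= 2^-1 ^+ i.+1.
Proof.
have q0 : 0 < q by apply: lt_le_trans q_ge2.
rewrite invr_ge0 exprn_ge0 ?(ltW q0)//= -exprVn.
by rewrite ler_pXn2r ?nnegrE ?invr_ge0 ?(ltW q0)// lef_pV2 ?posrE.
Qed.

Lemma half_exp_le i : 0 <= (2^-1 : real) ^+ i.+1 <= 2^-1.
Proof.
rewrite exprn_ge0 ?invr_ge0//= exprS ger_pMr ?invr_gt0//.
by rewrite exprn_ile1 ?invr_ge0// invf_le1 ?ler1n.
Qed.

Lemma euler_prod_noninc : {homo euler_prod : n m / (n <= m)%N >-> m <= n}.
Proof.
have ge0 n : 0 <= euler_prod n.
  apply: prodr_ge0 => i _; have := euler_factor i; have := half_exp_le i; lra.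
apply/nonincreasing_seqP => n; rewrite {1}/euler_prod big_ord_recr /= ler_piMr ?ge0//.
have := euler_factor n; lra.
Qed.

(* The term 2^-(n+2) makes the induction work. *)
Lemma euler_prod_lower n : 4^-1 + 2^-1 ^+ n.+2 <= euler_prod n.+1.
Proof.
elim: n => [|n IHn].
  rewrite /euler_prod big_ord_recr big_ord0 /= mul1r.
  have := euler_factor 0; rewrite !expr1 !exprS expr0; lra.
rewrite /euler_prod big_ord_recr /=; move: IHn; rewrite -/(euler_prod n.+1).
have := euler_factor n.+1; have := half_exp_le n.+1; rewrite (exprS _ n.+2).
have := half_exp_le n; rewrite (exprS _ n.+1).
set y := _ ^+ n.+2; set x := q ^- _; set P := euler_prod _ => *; nra.
Qed.

Lemma euler_prod_cvg : exists2 c : real, 0 < c & euler_prod @ \oo --> c.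
Proof.
have lb : has_lbound (range euler_prod).
  exists 0 => _ [n _ <-]; apply: le_trans (euler_prod_noninc (leqnSn n)).
  by apply: le_trans (euler_prod_lower n); rewrite addr_ge0 ?exprn_ge0 ?invr_ge0.
have cvgP := nonincreasing_is_cvgn euler_prod_noninc lb.
exists (limn euler_prod) => //; apply: (@lt_le_trans _ _ 4^-1); first by rewrite invr_gt0.
apply: limr_ge => //; near=> n.
have n0 : (0 < n)%N by near: n; exact: nbhs_infty_ge.
rewrite -(prednK n0); apply: le_trans (euler_prod_lower _).
by rewrite lerDl exprn_ge0 ?invr_ge0.
Unshelve. all: by end_near. Qed.
End EulerProduct.

Lemma gl_ratio_euler (F : finFieldType) n : gl_ratio F n = euler_prod #|{: F}|%:R n.
Proof.
case: n => [|n].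
  rewrite /gl_ratio /euler_prod big_ord0 card_mx mul0n expn0 divr1.
  rewrite (_ : [set A | _]%SET = [set: 'M[F]_0]%SET); first by rewrite cardsT card_mx.
  by apply/setP => A; rewrite !finset.in_set unitmxE det_mx00 unitr1.
have -> : gl_ratio F n.+1 = #|'GL_n.+1[F]%g|%:R / #|{: 'M[F]_n.+1}|%:R.
  rewrite /gl_ratio -[X in _ = X%:R / _](card_imset _ val_inj); congr (#|pred_of_set _|%:R / _).
  apply/setP => A; apply/idP/imsetP => [|[u _ ->]]; last by rewrite finset.in_set; exact: (valP u).
  by rewrite finset.in_set => Au; exists (Sub A Au); rewrite ?SubK // finset.in_setT.
have F0 : (0 < #|{: F}|)%N by apply/card_gt0P; exists 0.
have q0 : #|{: F}|%:R != 0 :> real by rewrite pnatr_eq0 -lt0n.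
rewrite card_GL// card_mx natrM !natrX.
set q : real := #|F|%:R.
suff -> : forall m, q ^+ 'C(m, 2) * (\prod_(1 <= i < m.+1) (#|F| ^ i - 1))%N%:R
   = q ^+ (m * m) * euler_prod q m.
  by rewrite mulrC mulKf// expf_neq0.
elim=> [|m IHm]; first by rewrite big_nil /euler_prod big_ord0 !expr0.
rewrite big_nat_recr//= natrM binS bin1 /euler_prod big_ord_recr /= -/(euler_prod q m).
rewrite exprD mulrACA IHm natrB ?expn_gt0 ?F0// natrX.
have -> : (m.+1 * m.+1)%N = (m * m + (m + m.+1))%N by lia.
rewrite !exprD -[#|F|%:R]/q.
have qm : q ^+ m.+1 != 0 by rewrite expf_neq0.
by field.
Qed.

Section SurjectionRatio.
Local Open Scope classical_set_scope.
Variables (R : comNzRingType) (M : finModule R).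
Local Notation msize := #|{: fm_carrier M}|.

Lemma surj_ratio_le1 N : surj_ratio N M <= 1.
Proof.
rewrite /surj_ratio ler_pdivrMr ?ltr0n ?expn_gt0 ?msize_gt0// mul1r ler_nat.
by apply: leq_trans (max_card _) _; rewrite card_mx mul1n.
Qed.

(* A non-surjective map misses some value on the basis vectors. *)
Lemma card_nonsurj N : (#|~: surj_set N M| <= msize * msize.-1 ^ N)%N.
Proof.
pose avoid (y : fm_carrier M) := [set x : 'rV[fm_carrier M]_N | [forall i, x 0 i != y]]%SET.
have sub : ~: surj_set N M \subset (\bigcup_y avoid y)%SET.
  apply/fintype.subsetP => x; rewrite !finset.in_set => /asboolPn nx.
  apply: contrapT => /negP xn; apply: nx => y.
  have : ~~ [forall i, x 0 i != y].
    by apply: contra xn => xy; apply/finset.bigcupP; exists y; rewrite ?finset.in_set.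
  by rewrite negb_forall => /existsP[i /negPn/eqP <-]; exists (delta_mx 0 i); exact: lin_delta.
apply: leq_trans (subset_leq_card sub) _; apply: (@leq_trans (\sum_y #|avoid y|)).
  elim/big_rec2: _ => [|y n A _ An]; first by rewrite cards0.
  by apply: leq_trans (leq_card_setU _ _) _; rewrite leq_add2l.
rewrite -sum_nat_const; apply: leq_sum => y _.
pose h (x : 'rV[fm_carrier M]_N) : {ffun 'I_N -> fm_carrier M} := [ffun i => x 0 i].
have h_inj : injective h.
  by move=> u v /ffunP uv; apply/rowP => i; have := uv i; rewrite !ffunE.
have := card_ffun_on 'I_N (predC1 y); rewrite cardC1 card_ord => <-.
rewrite -(card_imset _ h_inj).
apply: subset_leq_card; apply/fintype.subsetP => _ /imsetP[x /[!finset.in_set] /forallP xy ->].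
by apply/ffun_onP => i; rewrite ffunE inE.
Qed.

Lemma surj_ratio_cvg : (fun N => surj_ratio N M) @ \oo --> (1 : real).
Proof.
have m0 : 0 < msize%:R :> real by rewrite ltr0n msize_gt0.
pose r : real := msize.-1%:R / msize%:R.
have r1 : `|r| < 1.
  by rewrite ger0_norm ?divr_ge0// ltr_pdivrMr// mul1r ltr_nat prednK ?msize_gt0.
apply: (@squeeze_cvgr _ _ _ _ (fun N => 1 - msize%:R * r ^+ N) (fun=> 1)).
- near=> N; rewrite surj_ratio_le1 andbT /surj_ratio lerBlDr -lerBlDl.
  have W0 : 0 < (msize ^ N)%N%:R :> real by rewrite ltr0n expn_gt0 msize_gt0.
  rewrite -[X in X - _](divff (lt0r_neq0 W0)) -mulrBl ler_pdivrMr//.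
  have -> : msize%:R * r ^+ N * (msize ^ N)%N%:R = (msize * msize.-1 ^ N)%N%:R.
    by rewrite natrM natrX [in RHS]natrX -mulrA -exprMn /r divfK// lt0r_neq0.
  rewrite -natrB; last by rewrite (leq_trans (max_card _))// card_mx mul1n.
  rewrite ler_nat; apply: leq_trans (card_nonsurj N).
  by rewrite leq_subLR cardsC card_mx mul1n.
- have h : (fun N => msize%:R * r ^+ N) @ \oo --> msize%:R * (0 : real).
    by apply: cvgMl_tmp; exact: cvg_expr.
  have E : (fun N => 1 - msize%:R * r ^+ N) @ \oo --> (1 - msize%:R * 0 : real).
    by apply: (@cvgB real real^o _ _ _ (fun=> 1)) => //; exact: cvg_cst.
  by move: E; rewrite mulr0 subr0.
- exact: cvg_cst.
Unshelve. all: by end_near. Qed.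
End SurjectionRatio.

Local Open Scope classical_set_scope.

Lemma cvg_sum_seq (T : Type) (l : seq T) (f : nat -> T -> real) (g : T -> real) :
  (forall x, f n x @[n --> \oo] --> g x) ->
  (fun n => \sum_(x <- l) f n x) @ \oo --> \sum_(x <- l) g x.
Proof.
move=> fg; elim: l => [|x l IHl].
  rewrite big_nil; under eq_fun do rewrite big_nil; exact: cvg_cst.
rewrite big_cons; under eq_fun do rewrite big_cons.
exact: (@cvgD real real^o _ _ _ _ _ _ _ (fg x) IHl).
Qed.

(** Reducing the coefficients modulo [p^k.+1] gives finitely many representatives; the positive
    exponent keeps the quotient nonzero. The pair form allows a choice of all levels at once. *)
Lemma finite_levels_exist (R : comNzRingType) (p : nat) (s : seq R) k :
  prime p -> (forall u : R, p%:R * u <> 1) -> int_generates_mod p s ->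
  exists L : {Q : finComNzRingType & {rmorphism R -> Q}},
    (forall y, exists x, tagged L x = y) /\
    (forall x, tagged L x = 0 <-> exists y, x = (p ^ k.+1)%N%:R * y).
Proof.
move=> pp pN sg; pose q := (p ^ k.+1)%N.
have q0 : (0 < q)%N by rewrite expn_gt0 prime_gt0.
pose reps : seq R := [seq \sum_i (c i)%:R * s`_i | c : {ffun 'I_(size s) -> 'I_q}].
have [||Q [rho rhoP]] := @finite_quotient_exists R q%:R reps.
- by move=> [b]; rewrite /q expnS natrM -mulrA; exact: pN.
- move=> r; have [c [r' rE]] := sg k.+1 r.
  have cq i : (`|(c i %% q)%Z| < q)%N.
    by rewrite -ltz_nat gez0_abs ?modz_ge0 ?ltz_pmod// eqz_nat -lt0n.
  exists (\sum_i (`|(c i %% q)%Z|%N)%:R * s`_i).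
    apply/fintype.imageP; exists [ffun i => Ordinal (cq i)] => //.
    by apply: eq_bigr => i _; rewrite ffunE.
  exists (\sum_i (c i %/ q)%Z%:~R * s`_i + r').
  rewrite rE mulrDr addrA; congr (_ + _); rewrite mulr_sumr -big_split.
  apply: eq_bigr => i _ /=; rewrite {1}(divz_eq (c i) q) -[(`|_|%N)%:R]/(_%:Z%:~R).
  rewrite gez0_abs ?modz_ge0 ?eqz_nat -?lt0n// intrD intrM mulrDl addrC mulrA.
  by rewrite (mulrC _%:R).
by exists (existT (fun Q : finComNzRingType => {rmorphism R -> Q}) Q rho).
Qed.

(** * The limit measure and its total mass *)

Section LimitMeasure.
Variables (R : comNzRingType) (F : finFieldType) (pi : {rmorphism R -> F}) (p : nat).
Hypothesis p_prime : prime p.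
Hypothesis pi_unit : forall r, pi r != 0 -> exists r', r * r' = 1.
Hypothesis pi_p : pi p%:R = 0.
Hypothesis pi_surj : forall y, exists x, pi x = y.
Hypothesis p_neq0 : forall k, (p ^ k)%N%:R != 0 :> R.
Variables (s : seq R) (s_gen : int_generates_mod p s).
Variables (Q : nat -> finComNzRingType) (rho : forall k, {rmorphism R -> Q k}).
Hypothesis rho_surj : forall k y, exists x, rho k x = y.
Hypothesis rho_ker : forall k x, rho k x = 0 <-> exists y, x = (p ^ k.+1)%N%:R * y.
Variable c : real.
Hypothesis c_gt0 : 0 < c.
Hypothesis gl_cvg : gl_ratio F @ \oo --> c.

Lemma card_field_ge2 : 2 <= (#|{: F}|%:R : real).
Proof. by rewrite ler_nat; apply/card_gt1P; exists 0, 1; rewrite eq_sym oner_neq0. Qed.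

Lemma gl_ratio_ge N : c <= gl_ratio F N.
Proof.
have noninc : {homo gl_ratio F : n m / (n <= m)%N >-> m <= n}.
  by move=> n m nm; rewrite !gl_ratio_euler; apply: euler_prod_noninc nm; exact: card_field_ge2.
apply: (ler_cvg_to gl_cvg (cvg_cst (gl_ratio F N))).
by near=> n; apply: noninc; near: n; exact: nbhs_infty_ge.
Unshelve. all: by end_near. Qed.

Definition mu_lim (M : finModule R) : real :=
  if `[< in_TR M >] then c / #|aut_ffun M|%:R else 0.

Lemma mu_in_TR N (M : finModule R) : ~ in_TR M -> mu rho N M = 0.
Proof. by move=> MN; apply: mu_eq0 => G GM; apply: MN; exists N, G. Qed.

Lemma mu_cvg M : (fun N => mu rho N M) @ \oo --> mu_lim M.
Proof.
rewrite /mu_lim; case: asboolP => [MT|MN]; last first.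
  by under eq_fun do rewrite (mu_in_TR _ MN); exact: cvg_cst.
have E : (fun N => gl_ratio F N * surj_ratio N M / #|aut_ffun M|%:R) @ \oo
    --> c * 1 / #|aut_ffun M|%:R.
  by apply: cvgMr_tmp; apply: cvgM => //; exact: surj_ratio_cvg.
rewrite mulr1 in E; apply: cvg_trans E; apply: near_eq_cvg.
have [N0 N0E] := in_TR_coker_set MT.
near=> N; have [|G GM] := N0E N; first by near: N; exact: nbhs_infty_ge.
by rewrite (mu_formula pi_unit pi_p pi_surj p_neq0 rho_surj rho_ker GM).
Unshelve. all: by end_near. Qed.

Lemma mu_lim_ge0 M : 0 <= mu_lim M.
Proof. by rewrite /mu_lim; case: ifP => // _; rewrite divr_ge0// ltW. Qed.

Lemma mu_le N M : mu rho N M <= gl_ratio F N / c * mu_lim M.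
Proof.
have [[G GM]|none] := pselect (exists G, coker_set N M G); last first.
  rewrite mu_eq0; last by move=> G GM; apply: none; exists G.
  rewrite mulr_ge0 ?mu_lim_ge0// divr_ge0 ?(ltW c_gt0)//.
  exact: le_trans (ltW c_gt0) (gl_ratio_ge N).
rewrite /mu_lim asboolT; last by exists N, G.
rewrite (mu_formula pi_unit pi_p pi_surj p_neq0 rho_surj rho_ker GM).
rewrite mulrA divfK ?lt0r_neq0// ler_wpM2r ?invr_ge0// ler_piMr ?surj_ratio_le1//.
exact: le_trans (ltW c_gt0) (gl_ratio_ge N).
Qed.

Lemma prob_mu N : prob_on_classes (mu rho N).
Proof.
split; first by move=> M; exact: mu_ge0.
- by move=> M1 M2; exact: (mu_mod_iso pi_unit pi_p rho_surj rho_ker).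
- by move=> l; exact: (sum_mu_le1 pi_unit pi_p rho_surj rho_ker).
- by move=> eps; exact: (sum_mu_ge p_prime pi_unit pi_p s_gen rho_surj rho_ker).
Qed.

Lemma sum_mu_lim_le1 l : pairwise_noniso l -> \sum_(M <- l) mu_lim M <= 1.
Proof.
move=> ln; apply: (ler_cvg_to (cvg_sum_seq (l := l) (@mu_cvg)) (cvg_cst (1 : real))).
by near=> N; case: (prob_mu N) => _ _ /(_ _ ln).
Unshelve. all: by end_near. Qed.

(* No mass escapes: mu_N <= (gl_ratio N / c) mu_lim termwise, and the factor
   tends to 1. *)
Lemma prob_mu_lim : prob_on_classes mu_lim.
Proof.
split; [exact: mu_lim_ge0 | | exact: sum_mu_lim_le1 | ].
- move=> M1 M2 M12.
  have E : (fun N => mu rho N M1) = (fun N => mu rho N M2).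
    by apply: funext => N; exact: (mu_mod_iso pi_unit pi_p rho_surj rho_ker N M12).
  have := @mu_cvg M2; rewrite -E => cvg2.
  exact: (cvg_unique (@Rhausdorff real) (@mu_cvg M1) cvg2).
move=> eps eps0; have eps2 : 0 < eps / 2 by rewrite divr_gt0.
(* Half of [eps] pays for the factor [gl_ratio F N / c], the other half for the mass that the list
   misses at stage [N]. *)
have [N Nle] : exists N, gl_ratio F N <= c + c * (eps / 2).
  have lt : c < c + c * (eps / 2) by rewrite ltrDl mulr_gt0.
  have [N _ NE] := cvgr_le _ gl_cvg _ lt.
  by exists N; apply: NE => /=.
have [_ _ _ /(_ _ eps2)[l ln lE]] := prob_mu N.
exists l => //; have S1 := sum_mu_lim_le1 ln.
have : \sum_(M <- l) mu rho N M <= gl_ratio F N / c * \sum_(M <- l) mu_lim M.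
  by rewrite mulr_sumr; apply: ler_sum => M _; exact: mu_le.
have S0 : 0 <= \sum_(M <- l) mu_lim M by apply: sumr_ge0 => M _; exact: mu_lim_ge0.
move: S0 S1 lE; set S := \sum_(M <- l) mu_lim M => S0 S1 lE mS.
have gS : gl_ratio F N / c * S <= (1 + eps / 2) * S.
  by rewrite ler_wpM2r// ler_pdivrMr// mulrDl mul1r (mulrC _ c).
have : eps / 2 * S <= eps / 2 by rewrite ler_piMr// ltW.
lra.
Qed.
End LimitMeasure.

(* p prime; R a local ring containing Z_p and finite as a Z_p-module; F the   *)
(* residue field of R (given by a surjective ring morphism pi : R -> F onto a *)
(* finite field).  muN N M = mu_{R,N}(M) is the Haar measure of the set of G  *)
(* in End_R(R^N) with Coker G = M; muR = mu_R; cR = c_R.                      *)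
Theorem theorem2p3 (p : nat) (R : comAlgType (padic_int p))
    (F : finFieldType) (pi : {rmorphism R -> F}) :
  prime p ->
  local_ring R ->
  Zp_subring R ->
  Zp_module_finite R ->
  (forall y : F, exists x : R, pi x = y) ->
  exists (muN : nat -> finModule R -> real) (muR : finModule R -> real) (cR : real),
    (* mu_{R,N}(M) is the Haar measure of {G | Coker G = M} *)
        (forall (N : nat) (M : finModule R), (0 < N)%N ->
           haar_value p (coker_set N M) (muN N M)) /\
        (* each mu_{R,N} is a probability measure on S_R (infinite cokernels
           have measure zero) *)
        (forall N : nat, (0 < N)%N -> prob_on_classes (muN N)) /\
        (* weak-* convergence mu_{R,N} -> mu_R (pointwise on the countable
           discrete set S_R), mu_R a probability measure supported on T_R *)
        (forall M : finModule R, muN N M @[N --> \oo] --> muR M) /\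
        prob_on_classes muR /\
        (forall M : finModule R, ~ in_TR M -> muR M = 0) /\
        (* c_R = lim |GL_n(F_R)| / |M_n(F_R)| = prod_{i>=1} (1 - |F_R|^-i) *)
        (fun n : nat => (#|[set A : 'M[F]_n | A \in unitmx]|%:R : real)
                          / (#|{: 'M[F]_n}|%:R : real)) @ \oo --> cR /\
        (fun n : nat => \prod_(i < n) (1 - (#|{: F}|%:R : real) ^- i.+1)) @ \oo --> cR /\
      (* mu_R(M) = c_R / #Aut_R(M) for M in T_R *)
        (forall (M : finModule R) (n : nat), in_TR M -> (aut_set M #= `I_n)%card ->
           muR M = cR / n%:R).
Proof.
move=> p_prime R_local R_sub R_fin pi_surj.
have pi_unit := local_residue_unit R_local pi_surj.
have p_neq0 := pX_neq0 p_prime R_sub.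
have p_nonu := @p_nonunit p p_prime R R_sub R_fin.
have pi_p : pi p%:R = 0.
  by apply/eqP/negPn/negP => /pi_unit[u]; exact: p_nonu.
have [s s_gen] := Zp_finite_generates p_prime R_fin.
have [L LE] := choice (fun k => finite_levels_exist k p_prime p_nonu s_gen).
pose Q k : finComNzRingType := tag (L k).
pose rho k : {rmorphism R -> Q k} := tagged (L k).
have rho_surj k : forall y, exists x, rho k x = y := (LE k).1.
have rho_ker k : forall x, rho k x = 0 <-> exists y, x = (p ^ k.+1)%N%:R * y := (LE k).2.
have [c c_gt0 euler_cvg] := euler_prod_cvg (card_field_ge2 F).
have gl_cvg : gl_ratio F @ \oo --> c.
  by rewrite (_ : gl_ratio F = euler_prod #|{: F}|%:R) //; apply: funext => n; exact: gl_ratio_euler.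
exists (mu rho), (mu_lim c), c; split.
  by move=> N M _; exact: (haar_mu pi_unit pi_p rho_surj rho_ker).
split; first by move=> N _; exact: (prob_mu p_prime pi_unit pi_p s_gen rho_surj rho_ker).
split; first exact: (mu_cvg pi_unit pi_p pi_surj p_neq0 rho_surj rho_ker gl_cvg).
split; first exact: (prob_mu_lim p_prime pi_unit pi_p pi_surj p_neq0 s_gen rho_surj rho_ker c_gt0 gl_cvg).
split; first by move=> M MN; rewrite /mu_lim asboolF.
split.
  rewrite (_ : (fun n : nat => _) = gl_ratio F)//; apply: funext => n.
  rewrite /gl_ratio; congr (_%:R / _); apply: eq_card => A.
  by rewrite finset.in_set; apply/idP/idP; rewrite inE.
split; first exact: euler_cvg.
by move=> M n MT /aut_set_card ->; rewrite /mu_lim asboolT.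
Qed.
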